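(* Let $\gamma=(\gamma_k)_{k\ge 1}$ be a sequence of real numbers. There exists a constant $L(\gamma)>0$ (not depending on $n$) such that for every finite martingale difference sequence $X=(X_1,\dots,X_n)$ (where $n\ge 1$ is an integer) which belongs to the class $\mathcal{M}_n(\gamma)$ and which satisfies $V_n^2(X)=1$ a.s., one has $$ \Delta_n(X)\le L(\gamma)\left(\frac{u_n\log n}{v_n(X)}\right),\qquad\text{where } u_n=\max_{1\le k\le n}\gamma_k . $$
   Context: Random variables are defined on a probability space with probability $\mu$ and expectation $E$. A finite martingale difference sequence $X=(X_1,\dots,X_n)$ with respect to an increasing filtration $(\mathcal{F}_k)_{0\le k\le n}$, where $\mathcal{F}_0$ is the trivial $\sigma$-algebra, is a sequence of real random variables such that $X_k$ is $\mathcal{F}_k$-measurable and $E(X_k\mid\mathcal{F}_{k-1})=0$ a.s. for $1\le k\le n$. Notation: $\sigma_k^2(X)=E(X_k^2\mid\mathcal{F}_{k-1})$, $\tau_k^2(X)=E(X_k^2)$ for $1\le k\le n$; $v_n^2(X)=\sum_{k=1}^n\tau_k^2(X)$ (with $v_n(X)>0$, as is implicit in the next definitions); $V_n^2(X)=\frac{1}{v_n^2(X)}\sum_{k=1}^n\sigma_k^2(X)$; $S_n(X)=X_1+\dots+X_n$; $$\Delta_n(X)=\sup_{t\in\mathbb{R}}\left|\mu\left(S_n(X)/v_n(X)\le t\right)-\Phi(t)\right|,$$ where $\Phi$ is the standard normal distribution function. Class $\mathcal{M}_n(\gamma)$: $X=(X_1,\dots,X_n)$ belongs to $\mathcal{M}_n(\gamma)$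 if $X$ is a martingale difference sequence with respect to some increasing filtration $(\mathcal{F}_k)_{0\le k\le n}$ (with $\mathcal{F}_0$ trivial) such that for every $1\le k\le n$, $$E(|X_k|^3\mid\mathcal{F}_{k-1})\le\gamma_k\,E(X_k^2\mid\mathcal{F}_{k-1})\quad\text{a.s.}$$ The quantities $\sigma_k^2(X)$ and $V_n^2(X)$ are taken with respect to this same filtration.
   Formalization: The formal theorem takes n ≥ 2 instead of n ≥ 1: at n = 1 the bound is 0 since log 1 = 0, and it fails for γ_k = 1 and X_1 = ±1 with probability 1/2 each, where Δ_1(X) > 0. *)

(* Defs.v *)
From HB Require Import structures.
From mathcomp Require Export all_boot all_order all_algebra.
From mathcomp Require Export all_classical all_reals all_analysis.
Set Implicit Arguments.
Unset Strict Implicit.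
Unset Printing Implicit Defensive.
Import Order.TTheory GRing.Theory Num.Theory.
Import numFieldNormedType.Exports.
Local Open Scope classical_set_scope.
Local Open Scope ring_scope.

(* Sequences (X_1, ..., X_n) and (F_0, ..., F_n) are encoded as families over
   nat; the values outside the ranges 1 <= k <= n and 0 <= k <= n are never
   used. *)

Definition filtration (d : measure_display) (T : measurableType d) (n : nat)
    (F : nat -> set (set T)) : Prop :=
  [/\ F 0%N = [set set0; setT],
      (forall k, (k <= n)%N ->
         sigma_algebra setT (F k) /\ F k `<=` measurable) &
      (forall j k, (j <= k <= n)%N -> F j `<=` F k)].

Definition measurable_wrt (d : measure_display) (T : measurableType d)
    (R : realType) (G : set (set T)) (Y : T -> R) : Prop :=
  forall B : set R, measurable B -> G (Y @^-1` B).

(* [Z] is a version of E(Y | G), where [G] is a sub-sigma-algebra and [Y] is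
   integrable or nonnegative. The integrals are extended-real, so a nonnegative
   [Y] need not be integrable; [Z] is nevertheless real-valued, i.e. the
   conditional expectation is required to be a.s. finite. *)
Definition condexp_version (d : measure_display) (T : measurableType d)
    (R : realType) (P : probability T R) (G : set (set T)) (Y Z : T -> R) :
    Prop :=
  measurable_wrt G Z /\
  forall A : set T, G A ->
    (\int[P]_(x in A) (Z x)%:E = \int[P]_(x in A) (Y x)%:E)%E.

Definition martingale_difference (d : measure_display) (T : measurableType d)
    (R : realType) (P : probability T R) (n : nat) (F : nat -> set (set T))
    (X : nat -> T -> R) : Prop :=
  filtration n F /\
  forall k, (1 <= k <= n)%N ->
    [/\ measurable_wrt (F k) (X k),
        P.-integrable setT (EFin \o X k) &
        condexp_version P (F k.-1) (X k) (cst 0)].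

Definition is_sigma2 (d : measure_display) (T : measurableType d)
    (R : realType) (P : probability T R) (n : nat) (F : nat -> set (set T))
    (X : nat -> T -> R) (sigma2 : nat -> T -> R) : Prop :=
  forall k, (1 <= k <= n)%N ->
    condexp_version P (F k.-1) (fun x => X k x ^+ 2) (sigma2 k).

(* The class M_n(gamma), with the witnessing filtration [F] made explicit.
   Second moments are finite, so that tau_k^2 and v_n are real numbers. Since
   the right-hand side of the third-moment condition is a.s. finite, so is its
   left-hand side: real-valued versions lose no generality, and by a.s.
   uniqueness it does not matter which versions are chosen. *)
Definition class_M (d : measure_display) (T : measurableType d)
    (R : realType) (P : probability T R) (n : nat) (gamma : nat -> R)
    (F : nat -> set (set T)) (X : nat -> T -> R) : Prop :=
  [/\ martingale_difference P n F X,
      (forall k, (1 <= k <= n)%N -> ('E_P[(fun x => X k x ^+ 2)%R] < +oo)%E) &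
      (forall k, (1 <= k <= n)%N ->
         exists m3 m2 : T -> R,
           [/\ condexp_version P (F k.-1) (fun x => `|X k x| ^+ 3) m3,
               condexp_version P (F k.-1) (fun x => X k x ^+ 2) m2 &
               {ae P, forall x, m3 x <= gamma k * m2 x}])].

Definition tau2 (d : measure_display) (T : measurableType d) (R : realType)
    (P : probability T R) (X : nat -> T -> R) (k : nat) : R :=
  fine ('E_P[(fun x => X k x ^+ 2)%R])%E.

Definition vn2 (d : measure_display) (T : measurableType d) (R : realType)
    (P : probability T R) (n : nat) (X : nat -> T -> R) : R :=
  \sum_(1 <= k < n.+1) tau2 P X k.

Definition vn (d : measure_display) (T : measurableType d) (R : realType)
    (P : probability T R) (n : nat) (X : nat -> T -> R) : R :=
  Num.sqrt (vn2 P n X).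

Definition Vn2 (d : measure_display) (T : measurableType d) (R : realType)
    (P : probability T R) (n : nat) (X : nat -> T -> R)
    (sigma2 : nat -> T -> R) (x : T) : R :=
  (vn2 P n X)^-1 * \sum_(1 <= k < n.+1) sigma2 k x.

Definition Sn (d : measure_display) (T : measurableType d) (R : realType)
    (n : nat) (X : nat -> T -> R) (x : T) : R :=
  \sum_(1 <= k < n.+1) X k x.

Definition Phi (R : realType) (t : R) : R :=
  fine (normal_prob 0 1 `]-oo, t]%classic).

(* The supremum is over a nonempty subset of [0, 1], so it is a genuine one. *)
Definition Delta (d : measure_display) (T : measurableType d) (R : realType)
    (P : probability T R) (n : nat) (X : nat -> T -> R) : R :=
  sup [set `|fine (P [set x | Sn n X x / vn P n X <= t]) - Phi t| | t in [set: R]].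

Definition un (R : realType) (n : nat) (gamma : nat -> R) : R :=
  \big[Num.max/gamma 1%N]_(1 <= k < n.+1) gamma k.

(* Main.v *)
(* Smooth the distribution function of S_n at a scale a = M u and compare it
   with the normal one by Lindeberg's telescoping, where the smoothing at time k
   has variance L_k = a^2 + (remaining conditional variance), known one step
   ahead because V_n^2 = 1. The k-th error is at most
     C u E[sigma_k^2 L_k^(-3/2) h((t - S_(k-1)) / sqrt L_k)],  h(x) = 1 / (1 + x^2).
   Jensen's inequality given F_(k-1) replaces S_(k-1) by S_n at the cost of a
   constant factor; then the sum over k is bounded pathwise by a sum over the
   dyadic scales 2^i a, for which
     E[h((t - S_n) / l)] <= C (Delta + l / v).
   Altogether Delta <= C u Delta / a + C M (u / v) log n + (smoothing error); for
   M large the terms in Delta on the right are absorbed. The constant obtained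
   does not depend on gamma. *)
From HB Require Import structures.
Require Import Defs.
From mathcomp Require Import ring lra measurable_realfun.
Set Implicit Arguments.
Unset Strict Implicit.
Unset Printing Implicit Defensive.
Import Order.TTheory GRing.Theory Num.Theory.
Import numFieldNormedType.Exports.
Local Open Scope classical_set_scope.
Local Open Scope ring_scope.

(** * Gaussian distribution function *)

(** The steps X_k are unbounded, and this dictates the envelope h. When y is comparable to a large
    x, the increment of [Phi] between x and x - y can be of order 1, so a remainder bound of the
    form |y|^3 h(x) rules out Gaussian decay of h. At the same time h must be convex as a function
    of 1 + x^2 for Jensen's inequality. Conditional statements are tested against weights measurable
    at time k; hence the smoothing variance used in step k + 1 has to be known at time k. The
    third-moment condition forces sigma_k^2 <= u^2, so for a >= u one step at most halves this
    variance. No concentration bound for S_n is available in advance: it is read off from Delta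
    itself, which makes the estimate circular. Two parameters break the circle: M = a / u for the
    Lindeberg error, and a shift of t by c a for the removal of the smoothing. The logarithm counts
    scales. The weight of the scale l is of order 1 / l, so the terms Delta / l sum geometrically,
    while the part l / v contributes the same amount at every scale; since v^2 <= n u^2, there are
    O(log n) scales. *)

Section derive_rules.
Context {R : realType}.
Implicit Types (f g : R -> R) (x a b : R).

(** Pointwise forms of the differentiation rules: the derivative of an explicit function is
    assembled as a term, and [deriv_eq] then leaves a field identity for its value. *)
Lemma deriv_eq f x a b : is_derive x 1 f a -> a = b -> is_derive x 1 f b.
Proof. by move=> h <-. Qed.

Lemma deriv_cst x a : is_derive x 1 (fun=> a) 0.
Proof. exact: is_derive_cst. Qed.

Lemma deriv_id x : is_derive x 1 (fun y => y) 1.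
Proof. exact: is_derive_id. Qed.

Lemma derivD f g x a b : is_derive x 1 f a -> is_derive x 1 g b ->
  is_derive x 1 (fun y => f y + g y) (a + b).
Proof. exact: is_deriveD. Qed.

Lemma derivN f x a : is_derive x 1 f a -> is_derive x 1 (fun y => - f y) (- a).
Proof. exact: is_deriveN. Qed.

Lemma derivM f g x a b : is_derive x 1 f a -> is_derive x 1 g b ->
  is_derive x 1 (fun y => f y * g y) (f x * b + g x * a).
Proof. exact: is_deriveM. Qed.

Lemma derivX f n x a : is_derive x 1 f a ->
  is_derive x 1 (fun y => f y ^+ n) (n%:R * f x ^+ n.-1 * a).
Proof.
move=> h; have := @is_deriveX _ _ f n x 1 a h.
by rewrite (_ : f ^+ n = fun y => f y ^+ n)//; apply/funext => y; rewrite exprfctE.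
Qed.

Lemma derivV f x a : is_derive x 1 f a -> f x != 0 ->
  is_derive x 1 (fun y => (f y)^-1) (- (f x) ^- 2 * a).
Proof. by move=> ? ?; exact: is_deriveV. Qed.

Lemma deriv_comp f g x a b : is_derive (g x) 1 f a -> is_derive x 1 g b ->
  is_derive x 1 (fun y => f (g y)) (a * b).
Proof. exact: is_derive1_comp. Qed.

End derive_rules.

Definition phi {R : realType} : R -> R := normal_pdf 0 1.

(* Dominates, up to constants, every error term below, and is stable under
   perturbations of its argument. *)
Definition cauchy {R : realType} (x : R) : R := (1 + x ^+ 2)^-1.

Section Gaussian.
Context {R : realType}.
Implicit Types (a b c e m s t x y z : R).

Lemma phiE x : phi x = normal_peak 1 * expR (- x ^+ 2 / 2).
Proof.
rewrite /phi normal_pdfE ?oner_neq0// /normal_fun subr0 expr1n.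
by congr (_ * expR (_ / _)); rewrite mulr2n.
Qed.

Lemma normal_peak1_le1 : normal_peak 1 <= 1 :> R.
Proof.
rewrite /normal_peak invf_le1 ?sqrtr_gt0 ?expr1n ?mul1r; last first.
  by rewrite mulrn_wgt0// pi_gt0.
rewrite -{1}(@sqrtr1 R) ler_wsqrtr// mulr2n.
by have := @pi_ge2 R; lra.
Qed.

Lemma phi_ge0 x : 0 <= phi x.
Proof. exact: normal_pdf_ge0. Qed.

Lemma cauchy_gt0 x : 0 < cauchy x.
Proof. by rewrite invr_gt0; nra. Qed.

Lemma cauchy_le1 x : cauchy x <= 1.
Proof. by rewrite invf_le1; nra. Qed.

Lemma cauchyK x : cauchy x * (1 + x ^+ 2) = 1.
Proof. by rewrite mulVf// gt_eqF//; nra. Qed.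

(** The exponential is the inverse cube of exp(x^2/6) >= 1 + x^2/6 >= (1 + x^2)/6, and 216 = 6^3.
    Three powers of [cauchy] leave room for the polynomial factors in the derivatives of [phi]. *)
Lemma phi_decay x : phi x <= 216 * cauchy x ^+ 3.
Proof.
rewrite phiE.
have -> : - x ^+ 2 / 2 = - (3%:R * (x ^+ 2 / 6)) by field.
rewrite expRN expRM_natl.
have e1 : 1 + x ^+ 2 / 6 <= expR (x ^+ 2 / 6) by rewrite expR_ge1Dx.
have p0 : 0 < 1 + x ^+ 2 / 6 by nra.
apply: (@le_trans _ _ ((expR (x ^+ 2 / 6) ^+ 3)^-1)).
  by rewrite mulrC ler_piMr ?normal_peak1_le1// invr_ge0 exprn_ge0 ?expR_ge0.
rewrite /cauchy -exprVn.
have -> : 216 = 6 ^+ 3 :> R by ring.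
rewrite -exprMn ler_pXn2r// ?nnegrE ?invr_ge0 ?expR_ge0//; last first.
  by rewrite mulr_ge0// invr_ge0; nra.
rewrite -(invf_div (1 + x ^+ 2) 6) lef_pV2 ?posrE ?expR_gt0//; last first.
  by rewrite divr_gt0//; nra.
by apply: le_trans e1; nra.
Qed.

Lemma is_derive_phi x : is_derive x 1 phi (- x * phi x).
Proof.
have -> : phi = (fun x : R => normal_peak 1 * expR (- x ^+ 2 / 2)).
  by apply/funext => z; rewrite phiE.
apply: is_derive_eq; rewrite /GRing.scale/=.
set e := expR _; by field.
Qed.

Lemma is_derive_Phi x : is_derive x 1 (@Phi R) (phi x).
Proof.
have [||||d e] := @continuous_FTC1 R phi -oo%O x (x + 1) _ _ _ _.
- by rewrite ltrDl.
- exact: integrableS (integrable_normal_pdf 0 1).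
- by rewrite ltNyr.
- by apply: continuous_normal_pdf; rewrite oner_neq0.
- by rewrite -e derive1E; exact/derivableP.
Qed.

Lemma Phi_ge0 x : 0 <= Phi x.
Proof. exact: fine_ge0. Qed.

Lemma Phi_le1 x : Phi x <= 1.
Proof.
rewrite /Phi -lee_fin fineK ?fin_num_measure//.
exact: probability_le1.
Qed.

(** Turns the identity into a random variable under [normal_prob 0 1]; [Phi] is its cdf, and the
    limits at infinity are those of a cdf. *)
Local Lemma idRV_measurable : measurable_fun setT (idfun : measurableTypeR R -> R).
Proof. exact: measurable_id. Qed.

HB.instance Definition _ :=
  @isMeasurableFun.Build _ _ _ _ (idfun : measurableTypeR R -> R) idRV_measurable.

End Gaussian.

(** * Tails of the normal law and comparison with the indicator of a half-line *)

Section Gaussian_tails.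
Context {R : realType}.
Implicit Types (a b c e m s t x y z : R).

Lemma MVT_closed (f df : R -> R) a b : a <= b ->
  (forall x, a <= x <= b -> is_derive x 1 f (df x)) ->
  exists2 c, a <= c <= b & f b - f a = df c * (b - a).
Proof.
move=> ab fd; have [||c] := @MVT_segment R f df a b ab.
- by move=> x; rewrite in_itv/= => /andP[/ltW ? /ltW ?]; apply: fd; apply/andP.
- apply: derivable_within_continuous => x; rewrite in_itv/= => abx.
  by have [] := fd x abx.
- by rewrite in_itv/= => cab fE; exists c.
Qed.

Lemma MVT_norm (f df : R -> R) a b m :
  (forall x, Num.min a b <= x <= Num.max a b -> is_derive x 1 f (df x)) ->
  (forall x, Num.min a b <= x <= Num.max a b -> `|df x| <= m) ->
  `|f b - f a| <= m * `|b - a|.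
Proof.
wlog ab : a b / a <= b => [wl fd dm|].
  have [|/ltW ba] := leP a b; first by move=> /wl; apply.
  rewrite distrC (distrC b).
  by apply: wl => // x; rewrite minC maxC => ?; [exact: fd|exact: dm].
rewrite (min_l ab) (max_r ab) => fd dm.
have [c cab ->] := MVT_closed ab fd.
by rewrite normrM ler_wpM2r// dm.
Qed.

Lemma Phi_lip x y : `|Phi y - Phi x| <= `|y - x|.
Proof.
rewrite -[leRHS]mul1r; apply: (@MVT_norm _ phi) => z _.
- exact: is_derive_Phi.
- rewrite ger0_norm ?phi_ge0// /phi (le_trans (normal_pdf_ub _ _ _))//.
  exact: normal_peak1_le1.
Qed.

Lemma cvg_Phiy : (@Phi R) x @[x --> +oo] --> (1 : R).
Proof.
apply: fine_cvg => //.
have := @cvg_cdfy1 _ _ R (normal_prob 0 1) (idfun : measurableTypeR R -> R).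
exact.
Qed.

Lemma cvg_PhiNy : (@Phi R) x @[x --> -oo] --> (0 : R).
Proof.
apply: fine_cvg => //.
have := @cvg_cdfNy0 _ _ R (normal_prob 0 1) (idfun : measurableTypeR R -> R).
exact.
Qed.

Lemma phi_pow4 x : 0 < x -> phi x <= 216 / x ^+ 4.
Proof.
move=> x0; apply: (le_trans (phi_decay x)).
rewrite ler_pM2l// /cauchy exprVn lef_pV2 ?posrE ?exprn_gt0//; last by nra.
have : 0 <= x ^+ 2 by nra. 
by move: (x ^+ 2) (exprM x 2 2) => y -> y0; nra.
Qed.

Local Lemma is_derive_cube_inv x : 0 < x ->
  is_derive x 1 (fun y => (y ^+ 3)^-1 : R) (- 3 / x ^+ 4).
Proof.
move=> x0; have x3 : x ^+ 3 != 0 by rewrite expf_neq0// gt_eqF.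
apply: deriv_eq (derivV (derivX 3 (deriv_id x)) x3) _.
by rewrite /=; field; rewrite gt_eqF.
Qed.

(** By [phi_pow4], y |-> Phi y + 72 / y^3 has a nonpositive derivative on y > 0, and its limit is 1;
    here 72 = 216 / 3. A cubic tail is all that is used later. *)
Lemma Phi_upper_tail x : 0 < x -> 1 - Phi x <= 72 / x ^+ 3.
Proof.
move=> x0; rewrite lerBlDl; apply/ler_addgt0Pr => e e0.
have /cvgr_ge/(_ (1 - e)) := cvg_Phiy.
rewrite ltrBlDr ltrDl => /(_ e0)[A [_ hA]].
pose y := Num.max x A + 1.
have xy : x <= y by rewrite /y; have := le_max x x A; rewrite lexx; lra.
have Ay : A < y by rewrite /y; have := le_max A x A; rewrite lexx orbT; lra.
have h := hA _ Ay.
have [|z /andP[xz zy]] := @MVT_closed (fun y => Phi y + 72 * (y ^+ 3)^-1)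
  (fun y => phi y - 216 / y ^+ 4) x y xy _.
  move=> z /andP[xz zy]; have z0 := lt_le_trans x0 xz.
  apply: deriv_eq (derivD (is_derive_Phi z)
    (derivM (deriv_cst z 72) (is_derive_cube_inv z0))) _.
  by field; rewrite gt_eqF.
have z0 := lt_le_trans x0 xz; have y0 := lt_le_trans z0 zy.
have pz : (phi z - 216 / z ^+ 4) * (y - x) <= 0.
  by apply: mulr_le0_ge0; rewrite ?subr_le0 ?subr_ge0//; exact: phi_pow4.
have : 0 < (y ^+ 3)^-1 by rewrite invr_gt0 exprn_gt0.
by move: pz h => /=; lra.
Qed.

Lemma Phi_lower_tail x : 0 < x -> Phi (- x) <= 72 / x ^+ 3.
Proof.
move=> x0; apply/ler_addgt0Pr => e e0.
have /cvgr_le/(_ e e0)[A [_ hA]] := cvg_PhiNy.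
pose y := Num.max x (- A) + 1.
have xy : x <= y by rewrite /y; have := le_max x x (- A); rewrite lexx; lra.
have Ay : - y < A.
  by rewrite /y; have := le_max (- A) x (- A); rewrite lexx orbT; lra.
have h := hA _ Ay.
have [|z /andP[xz zy]] := @MVT_closed (fun y => Phi (- y) - 72 * (y ^+ 3)^-1)
  (fun y => - phi (- y) + 216 / y ^+ 4) x y xy _.
  move=> z /andP[xz zy]; have z0 := lt_le_trans x0 xz.
  apply: deriv_eq (derivD (deriv_comp (is_derive_Phi _) (derivN (deriv_id z)))
    (derivN (derivM (deriv_cst z 72) (is_derive_cube_inv z0)))) _.
  by field; rewrite gt_eqF.
have z0 := lt_le_trans x0 xz; have y0 := lt_le_trans z0 zy.
have pz : 0 <= (- phi (- z) + 216 / z ^+ 4) * (y - x).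
  have -> : phi (- z) = phi z by rewrite !phiE sqrrN.
  by apply: mulr_ge0; rewrite ?subr_ge0// addrC subr_ge0; exact: phi_pow4.
have : 0 < (y ^+ 3)^-1 by rewrite invr_gt0 exprn_gt0.
by move: pz h => /=; lra.
Qed.

(* The two halves of a Gaussian smoothing at scale 1, shifted by c: the error
   of the indicator is small both in c and far from the jump. *)
Lemma indic_le_Phi c x : 1 <= c ->
  (0 <= x)%R%:R <= Phi (x + c) + 72 / c * cauchy x.
Proof.
move=> c1; have c0 : 0 < c by lra.
have [x0|x0] := leP 0 x; last first.
  by rewrite addr_ge0 ?Phi_ge0// mulr_ge0 ?divr_ge0 ?(ltW (cauchy_gt0 _))// ltW.
rewrite -lerBlDl; apply: le_trans (Phi_upper_tail _) _; first lra.
(* For x >= 0 and c >= 1, (x + c)^3 >= c (1 + x^2): the cubic tail yields both [cauchy x] and the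
   gain 1 / c. *)
rewrite /cauchy -mulrA ler_pM2l// -invfM lef_pV2 ?posrE; nra.
Qed.

Lemma Phi_le_indic c x : 1 <= c ->
  Phi (x - c) <= (0 <= x)%R%:R + 72 / c * cauchy x.
Proof.
move=> c1; have c0 : 0 < c by lra.
have [x0|x0] := leP 0 x.
  by rewrite ler_wpDr ?Phi_le1// mulr_ge0 ?divr_ge0 ?(ltW (cauchy_gt0 _))// ltW.
rewrite add0r -opprB; apply: le_trans (Phi_lower_tail _) _; first lra.
rewrite /cauchy -mulrA ler_pM2l// -invfM lef_pV2 ?posrE; nra.
Qed.

End Gaussian_tails.

(** * Expansions of the normal distribution function in space and in variance *)

Section Gaussian_Taylor.
Context {R : realType}.
Implicit Types (b c d e m s t x y z : R).

Lemma cauchy_le_scale c x z : 1 <= c -> x ^+ 2 <= c * z ^+ 2 + c - 1 ->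
  cauchy z <= c * cauchy x.
Proof.
move=> c1 xz; have z0 : 0 < 1 + z ^+ 2 by nra.
by rewrite /cauchy ler_pdivlMr 1?mulrC ?ler_pdivrMr//; nra.
Qed.

Lemma phi_cauchy x : phi x <= 216 * cauchy x.
Proof.
apply: (le_trans (phi_decay x)); apply: ler_wpM2l; first exact: ler0n.
have := cauchy_gt0 x; have := cauchy_le1 x; set h := cauchy x => h1 h0.
by rewrite -[leRHS]expr1 ler_wiXn2l// ltW.
Qed.

Lemma abs_cauchy x : `|x| * cauchy x <= 1 / 2.
Proof.
have := cauchyK x; have := cauchy_gt0 x; set h := cauchy x => h0 hK.
suff : `|x| <= (1 + x ^+ 2) / 2 by nra.
by rewrite -(real_normK (num_real x)); have := sqr_ge0 (`|x| - 1); nra.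
Qed.

Lemma dphi_bound x : `|- x * phi x| <= 108 * cauchy x.
Proof.
rewrite normrM normrN (ger0_norm (phi_ge0 x)).
have := phi_decay x; have := abs_cauchy x; have := cauchy_gt0 x.
have := cauchy_le1 x; have := phi_ge0 x; have := normr_ge0 x.
set h := cauchy x; set p := phi x; set a := `|x| => a0 p0 h1 h0 ah ph.
apply: (@le_trans _ _ (a * (216 * h ^+ 3))); first by rewrite ler_wpM2l.
by rewrite exprS expr2; nra.
Qed.

(** The factor 1 + |x| lets one bound serve both (x^2 - 1) phi x and its product with x; the latter
    occurs in the second derivative with respect to the variance. *)
Lemma ddphi_bound x : (1 + `|x|) * `|(x ^+ 2 - 1) * phi x| <= 324 * cauchy x.
Proof.
have e : `|x ^+ 2 - 1| <= 1 + x ^+ 2.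
  by rewrite ler_norml; apply/andP; split; nra.
rewrite normrM (ger0_norm (phi_ge0 x)).
have := phi_decay x; have := abs_cauchy x; have := cauchy_gt0 x.
have := cauchy_le1 x; have := phi_ge0 x; have := normr_ge0 x; have := cauchyK x.
set h := cauchy x; set p := phi x; set a := `|x| => hK a0 p0 h1 h0 ah ph.
apply: (@le_trans _ _ ((1 + a) * ((1 + x ^+ 2) * (216 * h ^+ 3)))).
  by rewrite ler_wpM2l ?ler_pM ?addr_ge0.
have -> : (1 + x ^+ 2) * (216 * h ^+ 3) = 216 * h ^+ 2 * (h * (1 + x ^+ 2)).
  by ring.
by rewrite hK mulr1 expr2; nra.
Qed.

Lemma is_derive_dphi x :
  is_derive x 1 (fun y => - y * phi y) ((x ^+ 2 - 1) * phi x).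
Proof.
by apply: deriv_eq (derivM (derivN (deriv_id x)) (is_derive_phi x)) _; ring.
Qed.

Lemma MVT_norm0 (f df : R -> R) y m : f 0 = 0 -> 0 <= m ->
  (forall x, `|x| <= `|y| -> is_derive x 1 f (df x)) ->
  (forall x, `|x| <= `|y| -> `|df x| <= m) ->
  `|f y| <= m * `|y|.
Proof.
move=> f0 m0 fd dm; rewrite -[f y]subr0 -f0 -[in leRHS](subr0 y).
have h x : Num.min 0 y <= x <= Num.max 0 y -> `|x| <= `|y|.
  have [y0|y0] := leP 0 y => /andP[x1 x2].
  - by rewrite !ger0_norm.
  - by rewrite !ler0_norm ?lerN2// ltW.
by apply: MVT_norm => x /h; [exact: fd|exact: dm].
Qed.

(** The mean value bound is applied three times, to [g2] (second derivative), [g1] (first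
    derivative) and the remainder itself; each application gains a factor |y|. The 1/6 of Taylor's
    formula is given up. *)
Local Lemma taylor_near x y m : 0 <= m ->
  (forall z, `|z - x| <= `|y| -> `|(z ^+ 2 - 1) * phi z| <= m) ->
  `|Phi (x - y) - Phi x + y * phi x - y ^+ 2 / 2 * (- x * phi x)|
    <= m * `|y| ^+ 3.
Proof.
move=> m0 hm.
have dx (z : R) : is_derive z 1 (fun z => x - z) (-1).
  by apply: deriv_eq (derivD (deriv_cst z x) (derivN (deriv_id z))) _; rewrite add0r.
pose g2 s := - (x - s) * phi (x - s) - (- x * phi x).
pose g1 s := phi x - phi (x - s) - s * (- x * phi x).
have b2 s : `|s| <= `|y| -> `|g2 s| <= m * `|y|.
  move=> sy; apply: (@le_trans _ _ (m * `|s|)); last by rewrite ler_wpM2l.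
  apply: (@MVT_norm0 g2 (fun s => - (((x - s) ^+ 2 - 1) * phi (x - s)))).
  - by rewrite /g2 subr0 subrr.
  - exact: m0.
  - move=> z _; apply: deriv_eq (derivD (deriv_comp (is_derive_dphi _) (dx z))
      (deriv_cst z _)) _.
    by ring.
  - by move=> z zs; rewrite normrN hm// addrAC subrr add0r normrN (le_trans zs).
have b1 s : `|s| <= `|y| -> `|g1 s| <= m * `|y| ^+ 2.
  move=> sy; apply: (@le_trans _ _ (m * `|y| * `|s|)); last first.
    by rewrite expr2 mulrA ler_wpM2l// mulr_ge0.
  apply: (@MVT_norm0 g1 g2).
  - by rewrite /g1 subr0 subrr mul0r subr0.
  - by rewrite mulr_ge0.
  - move=> z _; apply: deriv_eq (derivD (derivD (deriv_cst z (phi x))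
      (derivN (deriv_comp (is_derive_phi _) (dx z))))
      (derivN (derivM (deriv_id z) (deriv_cst z _)))) _.
    by rewrite /g2; ring.
  - by move=> z zs; apply: b2; exact: le_trans zs sy.
have -> : m * `|y| ^+ 3 = m * `|y| ^+ 2 * `|y| by ring.
apply: (@MVT_norm0 (fun y => Phi (x - y) - Phi x + y * phi x
  - y ^+ 2 / 2 * (- x * phi x)) g1).
- by rewrite subr0 subrr mul0r expr0n/= !mul0r addr0 subr0.
- by rewrite mulr_ge0 ?exprn_ge0.
- move=> z _; apply: deriv_eq (derivD (derivD (derivD
    (deriv_comp (is_derive_Phi _) (dx z)) (deriv_cst z _))
    (derivM (deriv_id z) (deriv_cst z _)))
    (derivN (derivM (derivM (derivX 2 (deriv_id z)) (deriv_cst z _))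
      (deriv_cst z _)))) _.
  by rewrite /g1/=; field.
- exact: b1.
Qed.

(* If y is large compared to both 1 and x, each term of the expansion is
   individually dominated by |y|^3 cauchy x. *)
Lemma Phi_taylor_space x y :
  `|Phi (x - y) - Phi x + y * phi x - y ^+ 2 / 2 * (- x * phi x)|
    <= 1296 * (`|y| ^+ 3 * cauchy x).
Proof.
(* In this range every z within |y| of x satisfies cauchy z <= 4 cauchy x, and 1296 = 4 * 324. In
   the other range 1 + x^2 <= 5 |y|^3, so that even a term of order 1 is dominated. *)
have [hs|] := leP `|y| (Num.max 1 (`|x| / 2)).
  have -> : 1296 * (`|y| ^+ 3 * cauchy x) = 1296 * cauchy x * `|y| ^+ 3 by ring.
  apply: taylor_near; first by have := cauchy_gt0 x; lra.
  move=> z /le_trans/(_ hs) zx.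
  have hz : cauchy z <= 4 * cauchy x.
    apply: cauchy_le_scale; first lra.
    move: zx; rewrite le_max => /orP[]; rewrite ler_norml => /andP[z1 z2].
      have : 0 <= (z - x + 1) * (1 - (z - x)) by apply: mulr_ge0; lra.
      have := sqr_ge0 (2 * z - x); have := sqr_ge0 z.
      by rewrite !expr2; lra.
    have : 0 <= (z - x / 2) * (z + x / 2).
      have [x0|x0] := leP 0 x; move: z1 z2.
        by rewrite ger0_norm// => *; apply: mulr_ge0; lra.
      by rewrite ltr0_norm// => *; rewrite -mulrNN; apply: mulr_ge0; lra.
    by rewrite !expr2; lra.
  have := ddphi_bound z.
  have := normr_ge0 z; have := normr_ge0 ((z ^+ 2 - 1) * phi z).
  by set p := `|_ * _|; set q := `|z|; nra.
rewrite gt_max => /andP[y1 yx].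
have y3 : 1 <= 5 * (`|y| ^+ 3 * cauchy x) /\
    `|y| ^+ 2 * cauchy x <= `|y| ^+ 3 * cauchy x /\
    `|y| * cauchy x <= `|y| ^+ 3 * cauchy x.
  have h0 := cauchy_gt0 x; have hK := cauchyK x.
  have x2 : x ^+ 2 <= 4 * `|y| ^+ 2.
    by rewrite -(real_normK (num_real _)); have := normr_ge0 x; nra.
  have y2 : 1 <= `|y| ^+ 2 by nra.
  split; last split.
  - have y23 : `|y| ^+ 2 <= `|y| ^+ 3 by rewrite ler_weXn2l// ltW.
    have : cauchy x * (1 + x ^+ 2) <= cauchy x * (5 * `|y| ^+ 3).
      by rewrite ler_pM2l//; lra.
    by rewrite hK; lra.
  - by rewrite ler_wpM2r ?(ltW h0)// ler_weXn2l// ltW.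
  - by rewrite ler_wpM2r ?(ltW h0)// -[leLHS]expr1 ler_weXn2l// ltW.
move: y3 => [y3 [y2 {}y1]].
apply: le_trans (ler_normB _ _) _.
apply: le_trans (lerD (ler_normD _ _) (lexx _)) _.
have e1 : `|Phi (x - y) - Phi x| <= 1.
  have := Phi_ge0 x; have := Phi_le1 x.
  have := Phi_ge0 (x - y); have := Phi_le1 (x - y).
  by rewrite ler_norml => *; apply/andP; split; lra.
have e2 : `|y * phi x| <= 216 * (`|y| * cauchy x).
  rewrite normrM (ger0_norm (phi_ge0 x)) mulrCA ler_wpM2l ?normr_ge0//.
  exact: phi_cauchy.
have e3 : `|y ^+ 2 / 2 * (- x * phi x)| <= 54 * (`|y| ^+ 2 * cauchy x).
  rewrite normrM; have := dphi_bound x; set p := `|- x * _| => hp.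
  rewrite normrM normrX [`|2^-1|]gtr0_norm ?invr_gt0//.
  have : 0 <= `|y| ^+ 2 * (108 * cauchy x - p).
    by rewrite mulr_ge0 ?exprn_ge0 ?subr_ge0.
  by set a := `|y| ^+ 2; lra.
lra.
Qed.

Local Lemma is_derive_scaled b s : 0 < s ->
  is_derive s 1 (fun s => b / Num.sqrt s) (- (b / Num.sqrt s) / (2 * s)).
Proof.
move=> s0; have r0 : Num.sqrt s != 0 by rewrite gt_eqF// sqrtr_gt0.
apply: deriv_eq (derivM (deriv_cst s b) (derivV (is_derive1_sqrt s0) r0)) _.
by move: (sqr_sqrtr (ltW s0)) r0; set r := Num.sqrt s => <- r0; field.
Qed.

(** This is the heat equation: the value is half the second derivative of b |-> Phi (b / sqrt s).
    Hence the quadratic term of a step y and the linear term of a change of variance have the same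
    coefficient. *)
Lemma is_derive_Phi_var b s : 0 < s ->
  is_derive s 1 (fun s => Phi (b / Num.sqrt s))
    (- (b / Num.sqrt s) * phi (b / Num.sqrt s) / (2 * s)).
Proof.
move=> s0; have r0 : 0 < Num.sqrt s by rewrite sqrtr_gt0.
apply: deriv_eq (deriv_comp (is_derive_Phi _) (is_derive_scaled b s0)) _.
by field; rewrite !gt_eqF.
Qed.

Lemma Phi_var_lip b s d : 0 < s -> 0 <= d ->
  `|Phi (b / Num.sqrt (s + d)) - Phi (b / Num.sqrt s)| <= 54 * (d / s).
Proof.
move=> s0 d0.
have -> : 54 * (d / s) = 54 / s * `|s + d - s|.
  by rewrite addrAC subrr add0r (ger0_norm d0); ring.
have sd : s <= s + d by rewrite lerDl.
apply: (@MVT_norm _ (fun s => Phi (b / Num.sqrt s))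
  (fun s => - (b / Num.sqrt s) * phi (b / Num.sqrt s) / (2 * s)) s (s + d) (54 / s));
  rewrite (min_l sd) (max_r sd) => z /andP[sz zd].
  by apply: is_derive_Phi_var; exact: lt_le_trans sz.
have z0 := lt_le_trans s0 sz.
rewrite normrM [`|_^-1|]ger0_norm ?invr_ge0 ?mulr_ge0 ?(ltW z0)//.
rewrite ler_pdivrMr ?mulr_gt0// mulrAC ler_pdivlMr//.
have := dphi_bound (b / Num.sqrt z); have := cauchy_le1 (b / Num.sqrt z).
by set p := `|_|; set h := cauchy _; nra.
Qed.

Lemma Phi_taylor_var b s d : 0 < s -> 0 <= d <= s ->
  `|Phi (b / Num.sqrt (s + d)) - Phi (b / Num.sqrt s)
    - d * (- (b / Num.sqrt s) * phi (b / Num.sqrt s) / (2 * s))|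
    <= 600 * (d ^+ 2 / s ^+ 2 * cauchy (b / Num.sqrt s)).
Proof.
move=> s0 /andP[d0 ds].
pose q z := - (b / Num.sqrt z) * phi (b / Num.sqrt z) / (2 * z).
pose m := 600 / s ^+ 2 * cauchy (b / Num.sqrt s).
have m0 : 0 <= m.
  apply: mulr_ge0; last exact: ltW (cauchy_gt0 _).
  by apply: divr_ge0; [exact: ler0n|exact: sqr_ge0].
have dq z : s <= z <= s + d -> `|q z - q s| <= m * d.
  move=> /andP[sz zd].
  apply: (@le_trans _ _ (m * `|z - s|)); last first.
    by rewrite ler_wpM2l// ger0_norm ?subr_ge0// lerBlDl.
  apply: (@MVT_norm _ q (fun z => - (- (b / Num.sqrt z) * phi (b / Num.sqrt z))
    / (2 * z ^+ 2) - ((b / Num.sqrt z) ^+ 2 - 1) * phi (b / Num.sqrt z)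
    * (b / Num.sqrt z) / (4 * z ^+ 2)));
    rewrite (min_l sz) (max_r sz) => w /andP[sw wz]; have w0 := lt_le_trans s0 sw.
    apply: deriv_eq (derivM (deriv_comp (is_derive_dphi _) (is_derive_scaled b w0))
      (derivV (derivM (deriv_cst w 2) (deriv_id w)) _)) _.
      by rewrite gt_eqF// mulr_gt0.
    by field; rewrite !gt_eqF ?sqrtr_gt0.
  (* Since d <= s, the variance w lies between s and 2 s, whence b^2 / s <= 2 b^2 / w. *)
  have hw : cauchy (b / Num.sqrt w) <= 2 * cauchy (b / Num.sqrt s).
    apply: cauchy_le_scale; first lra.
    rewrite !expr_div_n !sqr_sqrtr ?(ltW s0) ?(ltW w0)//.
    have : b ^+ 2 / s <= 2 * (b ^+ 2 / w).
      by rewrite mulrA ler_pdivlMr// mulrAC ler_pdivrMr//; nra.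
    lra.
  have := dphi_bound (b / Num.sqrt w); have := ddphi_bound (b / Num.sqrt w).
  have h0 := cauchy_gt0 (b / Num.sqrt s).
  rewrite mulrDl mul1r; move: hw h0.
  set x := b / Num.sqrt w; set h := cauchy x; set k := cauchy _ => hk h0 b3 b2.
  have b3' : `|(x ^+ 2 - 1) * phi x * x| <= 324 * h.
    have := normr_ge0 ((x ^+ 2 - 1) * phi x).
    by rewrite (normrM _ x) (mulrC _ `|x|); lra.
  have -> : - (- x * phi x) / (2 * w ^+ 2) - (x ^+ 2 - 1) * phi x * x / (4 * w ^+ 2)
      = (- (- x * phi x) / 2 - (x ^+ 2 - 1) * phi x * x / 4) / w ^+ 2.
    by field; rewrite gt_eqF.
  rewrite normrM [`|_^-1|]ger0_norm ?invr_ge0 ?sqr_ge0//.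
  have n : `|- (- x * phi x) / 2 - (x ^+ 2 - 1) * phi x * x / 4| <= 300 * k.
    apply: le_trans (ler_normB _ _) _.
    rewrite !(normrM _ _^-1) normrN [`|2^-1|]gtr0_norm ?[`|4^-1|]gtr0_norm ?invr_gt0//.
    by move: b2 b3' hk; set A := `|_|; set B := `|_ * x|; lra.
  apply: (@le_trans _ _ (300 * k / w ^+ 2)).
    by rewrite ler_pM2r// invr_gt0 exprn_gt0.
  rewrite /m [leRHS]mulrAC -/k; apply: ler_pM.
  - by lra.
  - by rewrite invr_ge0 sqr_ge0.
  - by lra.
  - by rewrite lef_pV2 ?posrE ?exprn_gt0// ler_pXn2r// nnegrE ltW.
pose f z := Phi (b / Num.sqrt (s + z)) - Phi (b / Num.sqrt s) - z * q s.
have -> : 600 * (d ^+ 2 / s ^+ 2 * cauchy (b / Num.sqrt s)) = m * d * `|d - 0|.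
  by rewrite /m subr0 (ger0_norm d0); ring.
rewrite -[X in `|X|]subr0 -[X in `|_ - X|](_ : f 0 = _); last first.
  by rewrite /f addr0 subrr mul0r subr0.
apply: (@MVT_norm _ f (fun z => q (s + z) - q s));
  rewrite (min_l d0) (max_r d0) => z /andP[z0 zd].
  have sz : 0 < s + z by rewrite ltr_wpDr.
  apply: deriv_eq (derivD (derivD (deriv_comp (is_derive_Phi_var b sz)
    (derivD (deriv_cst z s) (deriv_id z))) (deriv_cst z _))
    (derivN (derivM (deriv_id z) (deriv_cst z _)))) _.
  by rewrite -/(q (s + z)); ring.
by apply: dq; rewrite lerDl z0 lerD2l.
Qed.

End Gaussian_Taylor.

Section one_step.
Context {R : realType}.
Implicit Types (b s u y : R).

(* Replacing a step y by a Gaussian one of variance s: the expansions of both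
   functions at b / sqrt l agree up to terms that cancel in expectation. *)
Lemma Phi_step_expansion : exists2 K : R, 0 < K &
  forall b l s u y, 0 <= u -> u ^+ 2 <= l -> 0 < l -> 0 <= s <= u ^+ 2 ->
  `|Phi ((b - y) / Num.sqrt l) - Phi (b / Num.sqrt (l + s))
    + phi (b / Num.sqrt l) / Num.sqrt l * y
    - - (b / Num.sqrt l) * phi (b / Num.sqrt l) / (2 * l) * (y ^+ 2 - s)|
  <= K * (cauchy (b / Num.sqrt l) / Num.sqrt l ^+ 3 * (`|y| ^+ 3 + u * s)).
Proof.
exists 1296; first exact: ltr0n.
move=> b l s u y u0 ul l0 /andP[s0 su].
have r0 : 0 < Num.sqrt l by rewrite sqrtr_gt0.
have lE : l = Num.sqrt l ^+ 2 by rewrite sqr_sqrtr// ltW.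
have := Phi_taylor_space (b / Num.sqrt l) (y / Num.sqrt l).
have := @Phi_taylor_var R b l s l0; rewrite s0 (le_trans su ul) => /(_ isT).
rewrite -mulrBl normrM normfV (gtr0_norm r0).
have ur : u <= Num.sqrt l.
  by rewrite -(ger0_norm u0) -sqrtr_sqr ler_wsqrtr.
(* From s <= u^2 <= u sqrt l: the error of the variance expansion takes the form of the third-moment
   error. *)
have sl : s ^+ 2 / l ^+ 2 <= u * s / Num.sqrt l ^+ 3.
  have -> : u * s / Num.sqrt l ^+ 3 = u * s * Num.sqrt l / l ^+ 2.
    by rewrite {3}lE; field; rewrite gt_eqF.
  rewrite ler_pM2r ?invr_gt0 ?exprn_gt0// expr2 -mulrA mulrCA.
  rewrite ler_wpM2l//; apply: (le_trans su); rewrite expr2.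
  by rewrite ler_wpM2l.
have hc := cauchy_gt0 (b / Num.sqrt l).
set h := cauchy _ in hc *; set x := b / Num.sqrt l.
set A := Phi x.
move=> h1 h2.
have {h1}h1 : `|Phi (b / Num.sqrt (l + s)) - A - s * (- x * phi x / (2 * l))|
    <= 1296 * (u * s / Num.sqrt l ^+ 3 * h).
  apply: (le_trans h1); apply: ler_pM; rewrite ?ler0n ?ler_nat//.
    by apply: mulr_ge0; [rewrite divr_ge0 ?sqr_ge0|exact: ltW].
  by rewrite ler_wpM2r ?(ltW hc).
rewrite (_ : 1296 * (h / _ * _) =
  1296 * ((`|y| / Num.sqrt l) ^+ 3 * h) + 1296 * (u * s / Num.sqrt l ^+ 3 * h)); last first.
  by field; rewrite gt_eqF.
apply: le_trans (lerD h2 h1).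
apply: le_trans (ler_normB _ _).
rewrite le_eqVlt; apply/orP; left; apply/eqP; congr `|_|.
rewrite /A /x; move: (Phi (b / Num.sqrt (l + s))) => q.
move: (Num.sqrt l) lE r0 {sl ur h1 h2 h hc A x} => w -> w0.
by move: (Phi _) (Phi _) (phi _) => P1 P2 p; field; rewrite gt_eqF.
Qed.

End one_step.

(** * Dyadic sums *)

Section dyadic.
Context {R : realType}.
Implicit Types (a b u x y c : R).

Lemma cauchy_mono x y : `|y| <= `|x| -> cauchy x <= cauchy y.
Proof.
move=> xy; rewrite lef_pV2 ?posrE ?ltr_wpDr ?sqr_ge0// lerD2l.
by rewrite -(real_normK (num_real x)) -(real_normK (num_real y)) lerXn2r ?nnegrE.
Qed.

(** On the annulus 2^(j-1) < |x| <= 2^j, [cauchy x] is at most 4^(1-j); the last term covers |x|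
    beyond the largest radius. This turns expectations of [cauchy] into probabilities of
    intervals. *)
Lemma cauchy_dyadic_le n x :
  cauchy x <= \sum_(j < n) 4 * (4 ^+ j)^-1 * (`|x| <= 2 ^+ j)%R%:R + 4 * (4 ^+ n)^-1.
Proof.
elim: n => [|n ih].
  by rewrite big_ord0 add0r expr0 invr1 mulr1 (le_trans (cauchy_le1 x))// ler1n.
have p0 : 0 < (4 ^+ n)^-1 :> R by rewrite invr_gt0 exprn_gt0.
rewrite big_ord_recr/=.
have [xn|xn] := leP `|x| (2 ^+ n).
  rewrite mulr1n mulr1; apply: (le_trans ih); rewrite -addrA lerD2l lerDl.
  by rewrite mulr_ge0 ?invr_ge0 ?exprn_ge0.
rewrite mulr0n mulr0 addr0 -[leLHS]add0r; apply: lerD.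
  by apply: sumr_ge0 => j _; rewrite mulr_ge0 ?ler0n// mulr_ge0// invr_ge0 exprn_ge0.
have -> : 4 * (4 ^+ n.+1)^-1 = (4 ^+ n)^-1 :> R.
  by rewrite exprS invfM mulrA mulfV ?mul1r.
rewrite /cauchy lef_pV2 ?posrE ?exprn_gt0 ?ltr_wpDr ?sqr_ge0//.
have -> : 4 ^+ n = (2 ^+ n) ^+ 2 :> R by rewrite -exprM mulnC exprM; congr (_ ^+ n); ring.
rewrite -(real_normK (num_real x)).
apply: (@le_trans _ _ (`|x| ^+ 2)); last by rewrite lerDr.
by rewrite lerXn2r ?nnegrE ?exprn_ge0// ltW.
Qed.

Lemma geometric_sum_le2 n c : 0 <= c <= 1 / 2 -> \sum_(j < n) c ^+ j <= 2.
Proof.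
move=> /andP[c0 c1]; suff : \sum_(j < n) c ^+ j + 2 * c ^+ n <= 2.
  by have := exprn_ge0 n c0; lra.
elim: n => [|n ih]; first by rewrite big_ord0 expr0; lra.
rewrite big_ord_recr/= exprS; have := exprn_ge0 n c0.
by move: ih; set s := \sum_(j < n) _; set p := c ^+ n; nra.
Qed.

Lemma dyadic_bucket n a x : a <= x < 2 ^+ n * a ->
  exists2 i, (i < n)%N & 2 ^+ i * a <= x < 2 ^+ i.+1 * a.
Proof.
elim: n => [|n ih] /andP[ax xn].
  by exfalso; move: xn; rewrite expr0 mul1r; lra.
have [xn'|nx] := ltP x (2 ^+ n * a); last by exists n => //; rewrite nx xn.
by have [|i ?] := ih; [rewrite ax xn'|exists i => //; exact: ltnW].
Qed.

(* The decreasing sequence L is cut at 2B; only steps from below 2B can land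
   below B, and on those the cut is inactive, so the sum telescopes. *)
Lemma sum_steps_below n c B (L : nat -> R) : 0 <= B ->
  (forall k, (k < n)%N -> 0 <= L k.+1 <= L k) ->
  (forall k, (k < n)%N -> L k <= 2 * L k.+1) ->
  \sum_(k < n) (L k - L k.+1) * (L k.+1 < B)%R%:R <= 2 * B.
Proof.
move=> B0 L1 L2.
apply: (@le_trans _ _ (Num.min (L 0%N) (2 * B) - Num.min (L n) (2 * B))).
  elim: n L1 L2 => [|n ih] L1 L2; first by rewrite big_ord0 subrr.
  rewrite big_ord_recr/=.
  have {}ih := ih (fun k kn => L1 k (ltnW kn)) (fun k kn => L2 k (ltnW kn)).
  have /andP[l0 l1] := L1 n (ltnSn n); have l2 := L2 n (ltnSn n).
  have [h|h] := ltP (L n.+1) B.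
    rewrite mulr1n mulr1 (min_l (_ : L n.+1 <= 2 * B)); last lra.
    by move: ih; rewrite (min_l (_ : L n <= 2 * B)); lra.
  rewrite mulr0n mulr0 addr0; apply: (le_trans ih).
  by rewrite lerD2l lerN2 le_min !ge_min l1 lexx/= orbT.
have m0 : Num.min (L 0%N) (2 * B) <= 2 * B by rewrite ge_min lexx orbT.
have [->|n0] := posnP n; first by rewrite subrr; lra.
have : 0 <= Num.min (L n) (2 * B).
  have kn : (n.-1 < n)%N by rewrite prednK.
  by have := L1 _ kn; rewrite prednK// le_min => /andP[-> _]/=; lra.
lra.
Qed.

(** Each sqrt(L_(k+1)) falls into some dyadic interval [2^i a, 2^(i+1) a), where the weight is at
    most (2^i a)^-3 and [cauchy] grows when its scale is raised to the upper endpoint. By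
    [sum_steps_below] the decrements landing there total at most 2 (2^(i+1) a)^2 = 8 (2^i a)^2. The
    gain is that the scales on the right do not depend on L, which will be random. *)
Lemma sum_cauchy_scales n m a b (L : nat -> R) : 0 < a ->
  (forall k, (k <= n)%N -> a ^+ 2 <= L k) ->
  (forall k, (k < n)%N -> 0 <= L k - L k.+1 <= a ^+ 2) ->
  (forall k, (k <= n)%N -> L k < (2 ^+ m * a) ^+ 2) ->
  \sum_(k < n) (L k - L k.+1) / Num.sqrt (L k.+1) ^+ 3
    * cauchy (b / Num.sqrt (L k.+1))
  <= \sum_(i < m) 8 / (2 ^+ i * a) * cauchy (b / (2 ^+ i.+1 * a)).
Proof.
move=> a0 aL LL Lm.
have c0 i : 0 < 2 ^+ i * a by rewrite mulr_gt0 ?exprn_gt0.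
pose h i := cauchy (b / (2 ^+ i.+1 * a)).
have h0 i : 0 <= h i by exact: ltW (cauchy_gt0 _).
apply: (@le_trans _ _ (\sum_(k < n) \sum_(i < m) (L k - L k.+1)
   * (L k.+1 < (2 ^+ i.+1 * a) ^+ 2)%R%:R * (((2 ^+ i * a) ^+ 3)^-1 * h i))).
  apply: ler_sum => k _; have kn := ltn_ord k.
  have aLk := aL k.+1 kn; have Lk0 : 0 < L k.+1.
    by apply: lt_le_trans aLk; rewrite exprn_gt0.
  have s0 : 0 < Num.sqrt (L k.+1) by rewrite sqrtr_gt0.
  have [//|i im /andP[i1 i2]] := @dyadic_bucket m a (Num.sqrt (L k.+1)).
    rewrite -{1}(ger0_norm (ltW a0)) -sqrtr_sqr ler_wsqrtr//=.
    by rewrite -(ger0_norm (ltW (c0 m))) -sqrtr_sqr ltr_sqrt ?Lm ?exprn_gt0.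
  have /andP[d0 _] := LL k kn.
  rewrite (bigD1 (Ordinal im))//= -[leLHS]addr0; apply: lerD; last first.
    apply: sumr_ge0 => j _; rewrite mulr_ge0 ?mulr_ge0 ?ler0n//.
    by rewrite invr_ge0 exprn_ge0// ltW.
  have -> : L k.+1 < (2 ^+ i.+1 * a) ^+ 2.
    by rewrite -(sqr_sqrtr (ltW Lk0)) ltrXn2r// ?nnegrE ?(ltW s0) ?(ltW (c0 _)).
  rewrite mulr1n mulr1 -mulrA ler_wpM2l//; apply: ler_pM.
  - by rewrite invr_ge0 exprn_ge0 ?(ltW s0).
  - exact: ltW (cauchy_gt0 _).
  - by rewrite lef_pV2 ?posrE ?exprn_gt0// lerXn2r ?nnegrE ?(ltW s0) ?(ltW (c0 _)).
  - apply: cauchy_mono; rewrite !normrM ler_wpM2l// !normfV.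
    by rewrite !gtr0_norm// lef_pV2 ?posrE// ltW.
rewrite exchange_big/=; apply: ler_sum => i _.
rewrite -mulr_suml.
set B := (2 ^+ i.+1 * a) ^+ 2.
have B0 : 0 <= B by exact: sqr_ge0.
have hs : \sum_(k < n) (L k - L k.+1) * (L k.+1 < B)%R%:R <= 2 * B.
  apply: sum_steps_below => // k kn; have /andP[l1 l2] := LL k kn.
    have := aL k.+1 kn; have := sqr_ge0 a.
    by move=> *; apply/andP; split; lra.
  by have := aL k.+1 kn; lra.
apply: (le_trans (ler_wpM2r _ hs)).
  by rewrite mulr_ge0// invr_ge0 exprn_ge0// ltW.
rewrite mulrA ler_wpM2r// /B (exprS 2 i) -(mulrA 2 (2 ^+ i)) le_eqVlt; apply/orP; left; apply/eqP.
by move: (gt_eqF (c0 i)) => /negbT ci; set c := 2 ^+ i * a in ci *; field.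
Qed.

End dyadic.

(** * Expectation and conditioning *)

Section measurability.
Context d (T : measurableType d) {R : realType}.
Implicit Types (f g : T -> R) (a : R).

Lemma measurable_fun_inv f a : 0 < a -> (forall x, a <= f x) ->
  measurable_fun setT f -> measurable_fun setT (fun x => (f x)^-1).
Proof.
move=> a0 af mf.
apply: (@measurable_comp _ _ _ _ _ _ (`]0, +oo[%classic : set R)
  (fun y : R => y^-1) setT f) => //.
- by move=> _ [x _ <-] /=; rewrite in_itv/= andbT (lt_le_trans a0).
- apply: open_continuous_measurable_fun; first exact: interval_open.
  move=> x; rewrite inE/= in_itv/= andbT => x0.
  by apply: (@inv_continuous R); rewrite gt_eqF.
Qed.

Lemma measurable_fun_sqrt f : measurable_fun setT f ->
  measurable_fun setT (fun x => Num.sqrt (f x)).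
Proof.
move=> mf; apply: (measurableT_comp _ mf).
by apply: continuous_measurable_fun => y; exact: sqrt_continuous.
Qed.

Lemma measurable_fun_phi f : measurable_fun setT f ->
  measurable_fun setT (fun x => phi (f x)).
Proof. by move=> mf; apply: (measurableT_comp _ mf); exact: measurable_normal_pdf. Qed.

Lemma measurable_fun_Phi f : measurable_fun setT f ->
  measurable_fun setT (fun x => Phi (f x)).
Proof.
move=> mf; apply: (measurableT_comp _ mf); apply: continuous_measurable_fun => y.
by apply: differentiable_continuous; apply/derivable1_diffP; have [] := is_derive_Phi y.
Qed.

Lemma measurable_fun_cauchy f : measurable_fun setT f ->
  measurable_fun setT (fun x => cauchy (f x)).
Proof.
move=> mf; apply: (@measurable_fun_inv _ 1) => //.
  by move=> x; rewrite lerDl sqr_ge0.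
by apply: measurable_funD => //; exact: measurable_funX.
Qed.

End measurability.

Section expectation.
Context d (T : measurableType d) {R : realType} (P : probability T R).
Implicit Types (f g W Y : T -> R) (a c m : R) (A : set T).

Local Notation "'Ex' f" := (\int[P]_x f x) (at level 10, f at level 9).
Local Notation intg f := (P.-integrable setT (EFin \o f)).

Lemma intg_measurable f : intg f -> measurable_fun setT f.
Proof. by case/integrableP => /measurable_EFinP. Qed.

Lemma intg_le f g : measurable_fun setT f -> (forall x, `|f x| <= g x) ->
  intg g -> intg f.
Proof.
move=> mf fg; apply: le_integrable => //; first exact/measurable_EFinP.
by move=> x _; rewrite /= lee_fin (le_trans (fg x))// ler_norm.
Qed.

Lemma intg_cst c : intg (cst c).
Proof. exact: finite_measure_integrable_cst. Qed.

Lemma intg_bounded f m : measurable_fun setT f -> (forall x, `|f x| <= m) -> intg f.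
Proof. by move=> mf fm; apply: (intg_le mf fm); exact: intg_cst. Qed.

Lemma intgD f g : intg f -> intg g -> intg (fun x => f x + g x).
Proof. by move=> fi gi; exact: (integrableD measurableT fi gi). Qed.

Lemma intgB f g : intg f -> intg g -> intg (fun x => f x - g x).
Proof. by move=> fi gi; exact: (integrableB measurableT fi gi). Qed.

Lemma intgZ c f : intg f -> intg (fun x => c * f x).
Proof. by move=> fi; exact: (integrableZl measurableT c fi). Qed.

Lemma intg_norm f : intg f -> intg (fun x => `|f x|).
Proof. exact: integrable_norm. Qed.

Lemma intgM W f m : measurable_fun setT W -> (forall x, `|W x| <= m) -> intg f ->
  intg (fun x => W x * f x).
Proof.
move=> mW Wm fi; apply: (@intg_le _ (fun x => m * `|f x|)).
- by apply: measurable_funM => //; exact: intg_measurable.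
- by move=> x; rewrite normrM ler_wpM2r.
- by apply: intgZ; exact: intg_norm.
Qed.

Lemma intg_sum n (f : nat -> T -> R) : (forall k, (k < n)%N -> intg (f k)) ->
  intg (fun x => \sum_(k < n) f k x).
Proof.
elim: n => [|n ih] h.
  by rewrite (_ : (fun x => _) = cst 0); [exact: intg_cst|apply/funext => x; rewrite big_ord0].
rewrite (_ : (fun x => _) = (fun x => \sum_(k < n) f k x + f n x)).
  by apply: intgD; [apply: ih => k kn; apply: h; exact: ltnW|exact: h].
by apply/funext => x; rewrite big_ord_recr.
Qed.

Lemma ExD f g : intg f -> intg g -> \int[P]_x (f x + g x) = Ex f + Ex g.
Proof. exact: RintegralD. Qed.

Lemma ExB f g : intg f -> intg g -> \int[P]_x (f x - g x) = Ex f - Ex g.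
Proof. exact: RintegralB. Qed.

Lemma ExZ c f : intg f -> \int[P]_x (c * f x) = c * Ex f.
Proof. exact: RintegralZl. Qed.

Lemma Ex_le f g : intg f -> intg g -> (forall x, f x <= g x) -> Ex f <= Ex g.
Proof. by move=> fi gi fg; apply: le_Rintegral. Qed.

Lemma Ex_cst c : \int[P]_x c = c.
Proof.
rewrite (Rintegral_cst _ measurableT) -[RHS]mulr1; congr (_ * _).
exact: (congr1 fine (probability_setT P)).
Qed.

Lemma Ex_norm f : intg f -> `|Ex f| <= \int[P]_x `|f x|.
Proof. exact: le_normr_Rintegral. Qed.

Lemma Ex_sum n (f : nat -> T -> R) : (forall k, (k < n)%N -> intg (f k)) ->
  \int[P]_x (\sum_(k < n) f k x) = \sum_(k < n) Ex (f k).
Proof.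
elim: n => [|n ih] h.
  by rewrite big_ord0; under eq_Rintegral do rewrite big_ord0; rewrite Ex_cst.
have hn k : (k < n)%N -> intg (f k) by move=> kn; apply: h; exact: ltnW.
rewrite big_ord_recr/= -ih// -ExD; [|exact: intg_sum|exact: h].
by apply: eq_Rintegral => x _; rewrite big_ord_recr.
Qed.

Lemma Ex_indic A : measurable A -> Ex (\1_A) = fine (P A).
Proof. by move=> mA; rewrite /Rintegral integral_indic// setIT. Qed.

Lemma intg_indic A : measurable A -> intg (\1_A).
Proof. exact: integrable_indic. Qed.

Lemma Ex_ae f g : measurable_fun setT f -> measurable_fun setT g ->
  {ae P, forall x, f x = g x} -> Ex f = Ex g.
Proof.
move=> mf mg fg; congr fine; apply: ae_eq_integral => //.
- exact/measurable_EFinP.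
- exact/measurable_EFinP.
- by apply: filterS fg => x fgx _; rewrite fgx.
Qed.

Lemma Ex_setE A f : measurable A -> \int[P]_(x in A) f x = \int[P]_x (\1_A x * f x).
Proof.
move=> mA; rewrite Rintegral_mkcond; apply: eq_Rintegral => x _.
by rewrite patchE indicE; case: ifP => _; rewrite ?mul1r ?mul0r.
Qed.

End expectation.

(** Measurability for [G] is phrased through the type generated by [G], so that the stability lemmas
    for [measurable_fun] apply; [measurable_wrtP] relates it to [measurable_wrt]. *)
Notation subfun G f := (@measurable_fun _ _ (g_sigma_algebraType G) _ setT f).

(** * From integrals over the sets of a sub-sigma-algebra to measurable weights *)

Section conditioning.
Context d (T : measurableType d) {R : realType} (P : probability T R).
Implicit Types (f W Y : T -> R) (A : set T) (G : set (set T)).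

Local Notation "'Ex' f" := (\int[P]_x f x) (at level 10, f at level 9).
Local Notation intg f := (P.-integrable setT (EFin \o f)).

Lemma measurable_wrtP G f : sigma_algebra setT G ->
  measurable_wrt G f <-> subfun G f.
Proof.
move=> sG; split => [fG _ B mB|fG B mB].
  by rewrite setTI measurable_g_measurableTypeE//; exact: fG.
have := fG measurableT B mB.
by rewrite setTI measurable_g_measurableTypeE.
Qed.

Lemma subfunS G H f : sigma_algebra setT G -> sigma_algebra setT H ->
  G `<=` H -> subfun G f -> subfun H f.
Proof.
move=> sG sH GH /(measurable_wrtP _ sG) fG; apply/(measurable_wrtP _ sH) => B mB.
by apply: GH; exact: fG.
Qed.

Lemma subfun_measurable G f : sigma_algebra setT G -> G `<=` measurable ->
  subfun G f -> measurable_fun setT f.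
Proof.
move=> sG GT /(measurable_wrtP _ sG) fG _ B mB.
by rewrite setTI; apply: GT; exact: fG.
Qed.

(** The sum is the minimum of n and the integer part of w. The two halves share an induction because
    the second one needs the first when w exceeds n. *)
Lemma sum_floor_indicator n (w : R) : 0 <= w ->
  (n%:R <= w -> \sum_(j < n) (j.+1%:R <= w)%R%:R = n%:R :> R) /\
  (w <= n%:R -> w - 1 <= \sum_(j < n) (j.+1%:R <= w)%R%:R <= w).
Proof.
move=> w0; elim: n => [|n [ih1 ih2]].
  by rewrite big_ord0; split => // ?; apply/andP; split; lra.
rewrite big_ord_recr/= -natr1.
have [nw|wn] := leP (n%:R + 1) w.
  by rewrite mulr1n ih1; [|lra]; split => // h; apply/andP; split; lra.
rewrite mulr0n addr0; split => [|h]; first by move=> ?; exfalso; lra.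
have [wn'|nw] := leP w n%:R; first exact: ih2.
by rewrite ih1 ?(ltW nw)//; apply/andP; split; lra.
Qed.

Section one_algebra.
Variable G : set (set T).
Hypotheses (sG : sigma_algebra setT G) (GT : G `<=` measurable).

Let level_set f c : subfun G f -> G [set x | c <= f x].
Proof.
move=> /(measurable_wrtP _ sG) /(_ `[c, +oo[%classic (measurable_itv _)).
by congr G; apply/seteqP; split => x /=; rewrite in_itv/= andbT.
Qed.

(** The function n W / m differs by at most 1 from the sum of the indicators of the level sets W >=
    m (j + 1) / n, which belong to [G]. Hence n E(W Y) <= m E|Y| for every n > 0, which is
    impossible if E(W Y) > 0. *)
Lemma cond_le0 W Y m : intg Y -> (forall A, G A -> \int[P]_(x in A) Y x <= 0) ->
  subfun G W -> (forall x, 0 <= W x <= m) -> \int[P]_x (W x * Y x) <= 0.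
Proof.
move=> iY YG GW W0.
have [m0|m0] := leP m 0.
  rewrite (_ : (fun x => _) = cst 0) ?Ex_cst//; apply/funext => x.
  have /andP[a b] := W0 x; rewrite (_ : W x = 0) ?mul0r//.
  by apply/eqP; rewrite eq_le a (le_trans b).
have mW := subfun_measurable sG GT GW.
have iWY : intg (fun x => W x * Y x).
  apply: (@intgM _ _ _ _ _ _ m) => // x.
  by have /andP[a b] := W0 x; rewrite ger0_norm.
suff h n : (0 < n)%N -> n%:R * Ex (fun x => W x * Y x) <= m * Ex (fun x => `|Y x|).
  rewrite leNgt; apply/negP => E0.
  have [n] : exists n : nat, m * Ex (fun x => `|Y x|) / Ex (fun x => W x * Y x) < n.+1%:R.
    exists (Num.truncn (m * Ex (fun x => `|Y x|) / Ex (fun x => W x * Y x))).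
    exact: truncnS_gt.
  by rewrite ltr_pdivrMr// ltNge h.
move=> n0; have n0' : 0 < n%:R :> R by rewrite ltr0n.
pose A (j : nat) := [set x | m * j.+1%:R / n%:R <= W x].
have GA j : G (A j) by exact: level_set.
have mA j : measurable (A j) by exact/GT.
have iA j : intg (fun x => \1_(A j) x * Y x).
  apply: (@intgM _ _ _ _ (\1_(A j)) _ 1) => // x.
  by rewrite indicE; case: (_ \in _); rewrite ?normr1 ?normr0.
have iS : intg (fun x => \sum_(j < n) \1_(A j) x * Y x).
  by apply: (@intg_sum _ _ _ _ n (fun j x => \1_(A j) x * Y x)) => k _; exact: iA.
rewrite -ExZ//.
apply: (@le_trans _ _ (Ex (fun x => m * (\sum_(j < n) \1_(A j) x * Y x) + m * `|Y x|))).
  apply: Ex_le.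
  - exact: intgZ.
  - by apply: intgD; apply: intgZ => //; exact: intg_norm.
  move=> x; rewrite -mulr_suml.
  have -> : \sum_(i < n) \1_(A i) x = \sum_(j < n) (j.+1%:R <= n%:R * W x / m)%R%:R :> R.
    apply: eq_bigr => j _; rewrite indicE; congr (nat_of_bool _)%:R.
    rewrite ler_pdivlMr//; apply/idP/idP; rewrite inE /A/=.
      by rewrite ler_pdivrMr// (mulrC m) (mulrC (W x)).
    by rewrite ler_pdivrMr// (mulrC m) (mulrC (W x)).
  have /andP[W1 W2] := W0 x.
  have w0 : 0 <= n%:R * W x / m by rewrite divr_ge0 ?mulr_ge0// ltW.
  have [_] := sum_floor_indicator n w0.
  have wn : n%:R * W x / m <= n%:R by rewrite ler_pdivrMr// ler_pM2l.
  move=> /(_ wn); set s := \sum_(j < n) _ => /andP[s1 s2].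
  have -> : n%:R * (W x * Y x) = m * (s * Y x) + m * ((n%:R * W x / m - s) * Y x).
    by field; rewrite gt_eqF.
  rewrite lerD2l ler_pM2l//.
  apply: (le_trans (ler_norm _)); rewrite normrM ler_piMl// ger0_norm; lra.
rewrite ExD; last 2 first.
- exact: intgZ.
- by apply: intgZ; exact: intg_norm.
rewrite ExZ// ExZ; last exact: intg_norm.
rewrite gerDr// pmulr_rle0// (@Ex_sum _ _ _ _ n (fun j x => \1_(A j) x * Y x)); last by move=> k _; exact: iA.
by apply: sumr_le0 => j _; rewrite -Ex_setE// YG.
Qed.

(** Adding the constant m makes the weight nonnegative without changing the integral, since Y has
    mean zero; [cond_le0] then applies to Y and to -Y. *)
Lemma cond_eq0_bounded W Y m : intg Y ->
  (forall A, G A -> \int[P]_(x in A) Y x = 0) ->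
  subfun G W -> (forall x, `|W x| <= m) -> \int[P]_x (W x * Y x) = 0.
Proof.
move=> iY YG GW Wm; have mW := subfun_measurable sG GT GW.
have iWY : intg (fun x => W x * Y x) by exact: (@intgM _ _ _ _ _ _ m).
have Y0 : Ex Y = 0.
  rewrite -(YG setT)//.
  by case: sG => G0 GD _; rewrite -(setD0 setT); exact: GD.
have GWm : subfun G (fun x => W x + m) by exact: measurable_funD.
have Wm2 x : 0 <= W x + m <= 2 * m.
  by have := Wm x; rewrite ler_norml => /andP[? ?]; apply/andP; split; lra.
have e : Ex (fun x => (W x + m) * Y x) = Ex (fun x => W x * Y x).
  rewrite -[RHS]addr0 -(mulr0 m) -Y0 -ExZ// -ExD//; last exact: intgZ.
  by apply: eq_Rintegral => x _; rewrite mulrDl.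
apply/eqP; rewrite eq_le -e; apply/andP; split.
  by apply: (cond_le0 iY _ GWm Wm2) => A GA; rewrite YG.
have iNY : intg (fun x => (-1) * Y x) by exact: intgZ.
have iWmY : intg (fun x => (W x + m) * Y x).
  apply: (@intgM _ _ _ _ _ _ (2 * m)) => //.
    exact: subfun_measurable GWm.
  by move=> x; have /andP[? ?] := Wm2 x; rewrite ger0_norm.
have := cond_le0 iNY _ GWm Wm2; rewrite -oppr_le0 => h.
rewrite -mulN1r -ExZ//; apply: le_trans (h _) => [|A GA].
  by rewrite le_eqVlt; apply/orP; left; apply/eqP/eq_Rintegral => x _; ring.
rewrite RintegralZl ?YG ?mulr0//; first exact: GT.
by apply: integrableS iY => //; exact: GT.
Qed.

(** Truncation of W at +-n and dominated convergence with bound |W Y|. The unbounded weight is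
    needed for the cross terms (S_j - S_k) X_(j+1). *)
Lemma cond_eq0 W Y : intg Y -> intg (fun x => W x * Y x) ->
  (forall A, G A -> \int[P]_(x in A) Y x = 0) ->
  subfun G W -> \int[P]_x (W x * Y x) = 0.
Proof.
move=> iY iWY YG GW; have mW := subfun_measurable sG GT GW.
pose Wn (n : nat) x := Num.max (- n%:R) (Num.min (W x) n%:R).
have GWn n : subfun G (Wn n).
  apply: measurable_maxr; first exact: measurable_cst.
  by apply: measurable_minr => //; exact: measurable_cst.
have Wnn n x : `|Wn n x| <= n%:R.
  rewrite ler_norml /Wn le_max lexx/= ge_max ge_min lexx orbT andbT.
  by have := ler0n R n; lra.
have WnW n x : `|Wn n x| <= `|W x|.
  have := ler0n R n; have := ler_norm (W x); have := ler_norm (- W x).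
  rewrite normrN /Wn ler_norml le_max ge_max ge_min => h1 h2 n0.
  apply/andP; split; last by rewrite h2 andbT; have := normr_ge0 (W x); lra.
  rewrite le_min; apply/orP; right; apply/andP; split; first by lra.
  by have := normr_ge0 (W x); lra.
have : (fun n => \int[P]_x (Wn n x * Y x)%:E)%E @ \oo -->
    (\int[P]_x (W x * Y x)%:E)%E.
  have [] := @dominated_convergence _ T R P setT measurableT
    (fun n x => (Wn n x * Y x)%:E) (fun x => (W x * Y x)%:E)
    (fun x => (`|W x * Y x|)%:E) _ _ _ _ _ => //.
  - move=> n; apply/measurable_EFinP; apply: measurable_funM.
      exact: subfun_measurable (GWn n).
    exact: intg_measurable iY.
  - apply/measurable_EFinP; apply: measurable_funM => //.
    exact: intg_measurable iY.
  - apply: aeW => x _; apply: cvg_near_cst; near=> n.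
    congr (_ * _)%:E; rewrite /Wn.
    have : `|W x| <= n%:R by near: n; exact: nbhs_infty_ger.
    by rewrite ler_norml => /andP[h1 h2]; rewrite (min_l h2) (max_r h1).
  - exact: intg_norm.
  - by apply: aeW => x n _; rewrite /= lee_fin !normrM ler_wpM2r.
rewrite (_ : (fun n => _) = cst 0%E); last first.
  apply/funext => n.
  have iWn : intg (fun x => Wn n x * Y x).
    by apply: (@intgM _ _ _ _ (Wn n) _ n%:R) => //; exact: subfun_measurable (GWn n).
  have := cond_eq0_bounded iY YG (GWn n) (Wnn n).
  by rewrite /Rintegral -[0%E]/(0%R%:E) => <-; rewrite fineK//; exact: integrable_fin_num.
by move=> /(cvg_unique _ (cvg_cst _)) h; rewrite /Rintegral -h.
Unshelve. all: by end_near. Qed.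

End one_algebra.
End conditioning.

(** * Moment inequalities for versions of conditional expectations *)

Section conditional_moments.
Context d (T : measurableType d) {R : realType} (P : probability T R).
Variable G : set (set T).
Hypotheses (sG : sigma_algebra setT G) (GT : G `<=` measurable).
Implicit Types (f g Y Z : T -> R) (A : set T) (c w : R).

Local Notation intg f := (P.-integrable setT (EFin \o f)).

Let GsetT : G setT.
Proof. by case: sG => G0 GD _; rewrite -(setD0 setT); exact: GD. Qed.

Let level_lt Z c : measurable_wrt G Z -> G [set x | Z x < c].
Proof.
move=> /(_ `]-oo, c[%classic (measurable_itv _)).
by congr G; apply/seteqP; split => x /=; rewrite in_itv.
Qed.

Let level_gt Z c : measurable_wrt G Z -> G [set x | c < Z x].
Proof.
move=> /(_ `]c, +oo[%classic (measurable_itv _)).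
by congr G; apply/seteqP; split => x /=; rewrite in_itv/= andbT.
Qed.

Let wrt_measurable Z : measurable_wrt G Z -> measurable_fun setT Z.
Proof. by move=> mZ _ B mB; rewrite setTI; apply: GT; exact: mZ. Qed.

Lemma condexp_ge0 Y Z : measurable_fun setT Y -> (forall x, 0 <= Y x) ->
  condexp_version P G Y Z -> {ae P, forall x, 0 <= Z x}.
Proof.
move=> mY Y0 [mZ YZ]; pose A := [set x | Z x < 0].
have GA : G A by exact: level_lt.
have mA : measurable A by exact: GT.
have mZ' := wrt_measurable mZ.
have h : (\int[P]_(x in A) `|(Z x)%:E| = 0)%E.
  have : (\int[P]_(x in A) (Z x)%:E = - \int[P]_(x in A) `|(Z x)%:E|)%E.
    rewrite -integral_ge0N; last by move=> x _; exact: abse_ge0.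
    apply: eq_integral => x; rewrite inE /A/= => zx.
    by rewrite ltr0_norm//= opprK.
  have : (0 <= \int[P]_(x in A) (Z x)%:E)%E.
    by rewrite YZ//; apply: integral_ge0 => x _; rewrite lee_fin.
  move=> + e; rewrite e oppe_ge0 => h; apply/eqP; rewrite eq_le h andTb.
  by apply: integral_ge0 => x _; exact: abse_ge0.
have : ae_eq P A (fun x => (Z x)%:E) (cst 0%E).
  apply/ae_eq_integral_abs => //; apply/measurable_EFinP; exact: measurable_funTS.
apply: filterS => x /= h'; rewrite leNgt; apply/negP => zx.
by move: zx (h' zx) => /= zx [z0]; rewrite z0 ltxx in zx.
Qed.

(** A version is nonnegative only almost surely; its absolute value is nonnegative everywhere, so
    the integral rules for nonnegative functions apply without integrability. *)
Lemma condexp_abs Y Z A : measurable_fun setT Y -> (forall x, 0 <= Y x) ->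
  condexp_version P G Y Z -> G A ->
  (\int[P]_(x in A) `|Z x|%:E = \int[P]_(x in A) (Y x)%:E)%E.
Proof.
move=> mY Y0 cYZ GA; have Z0 := condexp_ge0 mY Y0 cYZ.
case: cYZ => mZ YZ; have mZ' := wrt_measurable mZ.
rewrite -YZ//; apply: ae_eq_integral.
- exact: GT.
- by apply: measurable_funTS; apply/measurable_EFinP; exact: measurableT_comp.
- by apply: measurable_funTS; exact/measurable_EFinP.
- by apply: filterS Z0 => x zx _; rewrite ger0_norm.
Qed.

Lemma condexp_integrable Y Z : intg Y -> (forall x, 0 <= Y x) ->
  condexp_version P G Y Z -> intg Z.
Proof.
move=> iY Y0 cYZ; have mZ := wrt_measurable cYZ.1.
apply/integrableP; split; first exact/measurable_EFinP.
rewrite (condexp_abs (intg_measurable iY) Y0 cYZ)//.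
by have /integrableP[_] := iY; under eq_integral do rewrite /= ger0_norm//.
Qed.

(** The integrals stay extended because the finiteness of the third moment will be deduced from this
    inequality. The constant c may be negative, hence the larger w >= 0. *)
Lemma condexp_le Y3 Y2 m3 m2 c w A :
  measurable_fun setT Y3 -> measurable_fun setT Y2 ->
  (forall x, 0 <= Y3 x) -> (forall x, 0 <= Y2 x) ->
  condexp_version P G Y3 m3 -> condexp_version P G Y2 m2 ->
  {ae P, forall x, m3 x <= c * m2 x} -> c <= w -> 0 <= w -> G A ->
  (\int[P]_(x in A) (Y3 x)%:E <= w%:E * \int[P]_(x in A) (Y2 x)%:E)%E.
Proof.
move=> mY3 mY2 Y30 Y20 c3 c2 cm cw w0 GA.
have m30 := condexp_ge0 mY3 Y30 c3; have m20 := condexp_ge0 mY2 Y20 c2.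
rewrite -(condexp_abs mY3 Y30 c3 GA) -(condexp_abs mY2 Y20 c2 GA).
have mm2 : measurable_fun A (fun x => `|m2 x|%:E).
  apply: measurable_funTS; apply/measurable_EFinP; apply: measurableT_comp => //.
  exact: wrt_measurable c2.1.
rewrite -ge0_integralZl//; last exact: GT.
apply: ae_ge0_le_integral.
- exact: GT.
- by move=> x _; rewrite lee_fin.
- apply: measurable_funTS; apply/measurable_EFinP; apply: measurableT_comp => //.
  exact: wrt_measurable c3.1.
- by move=> x _; rewrite -EFinM lee_fin mulr_ge0.
- by apply: emeasurable_funM.
- apply: filterS3 m30 m20 cm => x a b h _; rewrite -EFinM lee_fin.
  by rewrite !ger0_norm// (le_trans h)// ler_wpM2r.
Qed.

Lemma cond_ae_le0 Z : intg Z -> measurable_wrt G Z ->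
  (forall A, G A -> \int[P]_(x in A) Z x <= 0) -> {ae P, forall x, Z x <= 0}.
Proof.
move=> iZ mZ hZ; pose A := [set x | 0 < Z x].
have GA : G A by exact: level_gt.
have mA : measurable A by exact: GT.
have iZA : P.-integrable A (EFin \o Z) by exact: integrableS iZ.
have h : (\int[P]_(x in A) `|(Z x)%:E| = 0)%E.
  apply/eqP; rewrite eq_le; apply/andP; split; last first.
    by apply: integral_ge0 => x _; exact: abse_ge0.
  have := hZ A GA; rewrite /Rintegral -lee_fin fineK; last first.
    exact: (integrable_fin_num mA iZA).
  apply: le_trans; rewrite le_eqVlt; apply/orP; left; apply/eqP.
  by apply: eq_integral => x; rewrite inE /A/= => zx; rewrite gtr0_norm.
have : ae_eq P A (fun x => (Z x)%:E) (cst 0%E).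
  by apply/ae_eq_integral_abs => //; exact: measurable_int iZA.
apply: filterS => x /= h'; rewrite leNgt; apply/negP => zx.
by move: zx (h' zx) => /= zx [z0]; rewrite z0 ltxx in zx.
Qed.

(** With y = |X|, the inequality (y - w)^2 (2 y + w) >= 0 reads w (y^2 - w^2) <= 2 (y^3 - w y^2).
    Integrated over sets of [G], this pointwise bound replaces the conditional inequality between
    second and third moments. *)
Lemma cond_variance_le X Z w : 0 < w -> intg (fun x => X x ^+ 2) ->
  intg (fun x => `|X x| ^+ 3) ->
  (forall A, G A -> \int[P]_(x in A) (`|X x| ^+ 3 - w * X x ^+ 2) <= 0) ->
  condexp_version P G (fun x => X x ^+ 2) Z -> {ae P, forall x, Z x <= w ^+ 2}.
Proof.
move=> w0 iX2 iX3 hX cZ; have iZ := condexp_integrable iX2 (fun x => sqr_ge0 _) cZ.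
have iw : intg (cst (w ^+ 2)) by exact: intg_cst.
suff : {ae P, forall x, Z x - w ^+ 2 <= 0}.
  by apply: filterS => x; rewrite subr_le0.
have i32 : intg (fun x => `|X x| ^+ 3 - w * X x ^+ 2).
  by apply: intgB => //; exact: intgZ.
apply: cond_ae_le0; first exact: intgB.
  apply/(measurable_wrtP _ sG); apply: measurable_funB => //.
  exact/(measurable_wrtP _ sG)/cZ.1.
move=> A GA; have mA := GT GA.
have iA f : intg f -> P.-integrable A (EFin \o f) by exact: integrableS.
rewrite RintegralB//; [|exact: iA|exact: iA].
rewrite (_ : \int[P]_(x in A) Z x = \int[P]_(x in A) (X x ^+ 2)); last first.
  by congr fine; exact: cZ.2.
rewrite -RintegralB//; [|exact: iA|exact: iA].
apply: (@le_trans _ _ (\int[P]_(x in A) (2 / w * (`|X x| ^+ 3 - w * X x ^+ 2)))).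
  apply: le_Rintegral => //; [by apply: iA; exact: intgB|by apply: iA; exact: intgZ|].
  move=> x _; rewrite mulrAC ler_pdivlMr// -(real_normK (num_real (X x))).
  have y0 := normr_ge0 (X x); set y := `|X x| in y0 *.
  have : 0 <= (y - w) ^+ 2 * (2 * y + w) by rewrite mulr_ge0 ?sqr_ge0//; lra.
  rewrite (_ : (y - w) ^+ 2 * _ = 2 * y ^+ 3 - 3 * w * y ^+ 2 + w ^+ 3); last by ring.
  rewrite (_ : (y ^+ 2 - w ^+ 2) * w = w * y ^+ 2 - w ^+ 3); last by ring.
  by lra.
rewrite RintegralZl//; last exact: iA.
by rewrite mulr_ge0_le0 ?hX// divr_ge0// ltW.
Qed.

End conditional_moments.

(** * Concentration and smoothing *)

Section concentration.
Context d (T : measurableType d) {R : realType} (P : probability T R).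
Variables (S : T -> R) (v D : R).
Hypotheses (mS : measurable_fun setT S) (v0 : 0 < v).
Hypothesis SD : forall t, `|fine (P [set x | S x <= t]) - Phi (t / v)| <= D.

Implicit Types (a b c t r l eps : R).

Let m_le t : measurable [set x | S x <= t].
Proof.
have := mS measurableT (measurable_itv `]-oo, t]).
by rewrite setTI; congr measurable; apply/seteqP; split => x /=; rewrite in_itv.
Qed.

Let m_near t r : measurable [set x | `|t - S x| <= r].
Proof.
have mf : measurable_fun setT (fun x => `|t - S x|).
  by apply: measurableT_comp => //; exact: measurable_funB.
have := mf measurableT _ (measurable_itv `]-oo, r]).
by rewrite setTI; congr measurable; apply/seteqP; split => x /=; rewrite in_itv.
Qed.

(** The distribution function measures half-open intervals; to contain the closed interval, the left
    endpoint is moved from t - r to t - 2 r. Each endpoint costs D, and the length 3 r enters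
    through the Lipschitz bound on [Phi]. *)
Lemma prob_near_le t r : 0 < r ->
  fine (P [set x | `|t - S x| <= r]) <= 2 * D + 3 * (r / v).
Proof.
move=> r0.
have h1 := SD (t + r); have h2 := SD (t - 2 * r).
have sub : [set x | `|t - S x| <= r] `<=`
    [set x | S x <= t + r] `\` [set x | S x <= t - 2 * r].
  move=> x /=; rewrite ler_norml => /andP[? ?]; split; first by lra.
  by apply/negP; rewrite -ltNge; lra.
have dE : fine (P ([set x | S x <= t + r] `\` [set x | S x <= t - 2 * r])) =
    fine (P [set x | S x <= t + r]) - fine (P [set x | S x <= t - 2 * r]).
  rewrite measureD//= ?ltey_eq ?fin_num_measure//.
  rewrite (_ : _ `&` _ = [set x | S x <= t - 2 * r]) ?fineB ?fin_num_measure//.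
  by apply/seteqP; split => x /=; [case|move=> ?; split => //; lra].
have : fine (P [set x | `|t - S x| <= r]) <=
    fine (P ([set x | S x <= t + r] `\` [set x | S x <= t - 2 * r])).
  have mD : measurable ([set x | S x <= t + r] `\` [set x | S x <= t - 2 * r]).
    exact: measurableD.
  by rewrite fine_le ?fin_num_measure// le_measure ?inE.
rewrite dE.
have := @Phi_lip R ((t - 2 * r) / v) ((t + r) / v).
rewrite -mulrBl (_ : t + r - (t - 2 * r) = 3 * r); last by ring.
rewrite [leRHS]ger0_norm; last by rewrite divr_ge0 ?mulr_ge0// ltW.
move: h1 h2; rewrite !ler_norml => /andP[? ?] /andP[? ?] /andP[? ?].
by rewrite mulrA; lra.
Qed.

(** In the dyadic sum the terms 4^(1-j) (2 D + 3 * 2^j l / v) add up to at most 16 D + 24 l / v; the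
    remainder beyond the last radius gives one more l / v. *)
Lemma expectation_cauchy_le t l : 0 < l ->
  \int[P]_x cauchy ((t - S x) / l) <= 16 * D + 25 * (l / v).
Proof.
move=> l0; have lv0 : 0 < l / v by exact: divr_gt0.
have D0 : 0 <= D by apply: le_trans (SD 0).
have [n hn] : exists n : nat, 4 * (4 ^+ n)^-1 <= l / v.
  have h : 4 / (l / v) <= (Num.truncn (4 / (l / v))).+1%:R.
    by rewrite ltW// truncnS_gt.
  exists (Num.truncn (4 / (l / v))).+1; move: h; set n := _.+1 => h.
  rewrite ler_pdivrMr ?exprn_gt0// mulrC -ler_pdivrMr//.
  by apply: (le_trans h); rewrite -natrX ler_nat ltnW// ltn_expl.
pose g x : R := \sum_(j < n) 4 * (4 ^+ j)^-1 * \1_[set x | `|t - S x| <= 2 ^+ j * l] x.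
have ig (j : nat) : P.-integrable setT
    (EFin \o (fun x => 4 * (4 ^+ j)^-1 * \1_[set x | `|t - S x| <= 2 ^+ j * l] x)).
  by apply: intgZ; exact: intg_indic.
have mc : measurable_fun setT (fun x => cauchy ((t - S x) / l)).
  apply: measurable_fun_cauchy; apply: measurable_funM => //.
  exact: measurable_funB.
have le1 : \int[P]_x cauchy ((t - S x) / l) <= \int[P]_x (g x + l / v).
  apply: Ex_le.
  - apply: (@intg_bounded _ _ _ _ _ 1) => // x.
    by rewrite ger0_norm ?cauchy_le1// ltW// cauchy_gt0.
  - apply: intgD; last exact: intg_cst.
    exact: (@intg_sum _ _ _ _ n (fun (j : nat) x =>
      4 * (4 ^+ j)^-1 * \1_[set x | `|t - S x| <= 2 ^+ j * l] x)).
  move=> x; apply: le_trans (cauchy_dyadic_le n _) _.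
  apply: lerD => //; apply: ler_sum => j _; rewrite indicE.
  rewrite normrM normfV (gtr0_norm l0) ler_pdivrMr//.
  rewrite (_ : (x \in _) = (`|t - S x| <= 2 ^+ j * l))//.
  by apply/idP/idP; rewrite inE.
apply: (le_trans le1); rewrite ExD; last exact: intg_cst.
  rewrite Ex_cst (@Ex_sum _ _ _ _ n (fun (j : nat) x =>
    4 * (4 ^+ j)^-1 * \1_[set x | `|t - S x| <= 2 ^+ j * l] x)) => [|j _]; last first.
    exact: ig.
  apply: (@le_trans _ _ (\sum_(j < n) (8 * D * (1 / 4) ^+ j
      + 12 * (l / v) * (1 / 2) ^+ j) + l / v)).
    rewrite lerD2r; apply: ler_sum => j _.
    rewrite ExZ; last exact: intg_indic.
    rewrite Ex_indic//.
    have p0 : 0 < 2 ^+ j :> R by rewrite exprn_gt0.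
    have := @prob_near_le t (2 ^+ j * l); rewrite mulr_gt0// => /(_ isT) h.
    apply: (@le_trans _ _ (4 * (4 ^+ j)^-1 * (2 * D + 3 * (2 ^+ j * l / v)))).
      by rewrite ler_wpM2l// mulr_ge0 ?invr_ge0 ?exprn_ge0.
    have -> : (4 ^+ j) = (2 ^+ j) ^+ 2 :> R.
      by rewrite -exprM mulnC exprM; congr (_ ^+ j); ring.
    rewrite !expr_div_n !expr1n.
    have -> : (4 ^+ j) = (2 ^+ j) ^+ 2 :> R.
      by rewrite -exprM mulnC exprM; congr (_ ^+ j); ring.
    rewrite le_eqVlt; apply/orP; left; apply/eqP.
    by field; rewrite !gt_eqF.
  rewrite big_split/= -!mulr_sumr.
  have := @geometric_sum_le2 R n (1 / 4); have := @geometric_sum_le2 R n (1 / 2).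
  set s2 := \sum_(j < n) _; set s4 := \sum_(j < n) _ => h2 h4.
  have {}h2 : s2 <= 2 by apply: h2; apply/andP; split; lra.
  have {}h4 : s4 <= 2 by apply: h4; apply/andP; split; lra.
  have : D * s4 <= D * 2 by rewrite ler_wpM2l.
  have : l / v * s2 <= l / v * 2 by rewrite ler_wpM2l// ltW.
  by set w := l / v; lra.
exact: (@intg_sum _ _ _ _ n (fun (j : nat) x =>
      4 * (4 ^+ j)^-1 * \1_[set x | `|t - S x| <= 2 ^+ j * l] x)).
Qed.

(** Shifting t by c a either way places the indicator on one side of the smoothed function, up to 72
    / c times [cauchy]. The shift costs c a / v; in return D carries the factor 1 / c, so it can be
    absorbed later. *)
Lemma smoothing a c eps t : 0 < a -> 1 <= c ->
  (forall t, `|\int[P]_x Phi ((t - S x) / a) - Phi (t / v)| <= eps) ->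
  `|fine (P [set x | S x <= t]) - Phi (t / v)|
  <= eps + c * (a / v) + 72 / c * (16 * D + 25 * (a / v)).
Proof.
move=> a0 c1 He.
have av0 : 0 < a / v by exact: divr_gt0.
have c0 : 0 < c by lra.
have iP b : P.-integrable setT (EFin \o (fun x => Phi ((b - S x) / a))).
  apply: (@intg_bounded _ _ _ _ _ 1).
    by apply: measurable_fun_Phi; apply: measurable_funM => //; exact: measurable_funB.
  by move=> x; rewrite ger0_norm ?Phi_ge0 ?Phi_le1.
have ic : P.-integrable setT (EFin \o (fun x => cauchy ((t - S x) / a))).
  apply: (@intg_bounded _ _ _ _ _ 1).
    by apply: measurable_fun_cauchy; apply: measurable_funM => //; exact: measurable_funB.
  by move=> x; rewrite ger0_norm ?cauchy_le1// ltW// cauchy_gt0.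
have hc : 72 / c * \int[P]_x cauchy ((t - S x) / a) <=
    72 / c * (16 * D + 25 * (a / v)).
  by apply: ler_wpM2l (expectation_cauchy_le t a0); rewrite divr_ge0// ltW.
have i1 : P.-integrable setT (EFin \o \1_[set x | S x <= t]) by exact: intg_indic.
have indE x : \1_[set x | S x <= t] x = (0 <= (t - S x) / a)%R%:R :> R.
  rewrite indicE; congr (nat_of_bool _)%:R; rewrite pmulr_lge0 ?invr_gt0// subr_ge0.
  by apply/idP/idP; rewrite inE.
have ca : c * a / v = c * (a / v) by rewrite mulrA.
have cav : `|c * a / v| = c * (a / v) by rewrite ca ger0_norm// ltW// mulr_gt0.
rewrite -Ex_indic// ler_norml; apply/andP; split.
  have h : \int[P]_x Phi ((t - c * a - S x) / a) <=
      \int[P]_x (\1_[set x | S x <= t] x + 72 / c * cauchy ((t - S x) / a)).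
    apply: Ex_le; [exact: iP|by apply: intgD => //; exact: intgZ|move=> x].
    rewrite indE (_ : (t - c * a - S x) / a = (t - S x) / a - c).
      exact: Phi_le_indic.
    by field; rewrite gt_eqF.
  rewrite ExD ?ExZ// in h; last exact: intgZ.
  have := He (t - c * a); rewrite ler_norml => /andP[h1 _].
  have := Phi_lip (t / v) ((t - c * a) / v).
  rewrite -mulrBl (_ : t - c * a - t = - (c * a)); last by ring.
  rewrite mulNr normrN cav ler_norml => /andP[h2 _].
  lra.
have h : \int[P]_x (\1_[set x | S x <= t] x) <=
    \int[P]_x (Phi ((t + c * a - S x) / a) + 72 / c * cauchy ((t - S x) / a)).
  apply: Ex_le => //; [by apply: intgD => //; exact: intgZ|move=> x].
  rewrite indE (_ : (t + c * a - S x) / a = (t - S x) / a + c).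
    exact: indic_le_Phi.
  by field; rewrite gt_eqF.
rewrite ExD ?ExZ// in h; last exact: intgZ.
have := He (t + c * a); rewrite ler_norml => /andP[_ h1].
have := Phi_lip (t / v) ((t + c * a) / v).
rewrite -mulrBl (_ : t + c * a - t = c * a); last by ring.
rewrite cav ler_norml => /andP[_ h2].
lra.
Qed.

End concentration.

(** * Lindeberg's method *)

Section martingale.
Context d (T : measurableType d) {R : realType} (P : probability T R).
Variables (n : nat) (F : nat -> set (set T)) (X r : nat -> T -> R) (u v a : R).

Local Notation "'Ex' f" := (\int[P]_x f x) (at level 10, f at level 9).
Local Notation intg f := (P.-integrable setT (EFin \o f)).
Local Notation S := (fun k => Sn k X).

Hypothesis sF : forall k, (k <= n)%N -> sigma_algebra setT (F k).
Hypothesis FT : forall k, (k <= n)%N -> F k `<=` measurable.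
Hypothesis FS : forall j k, (j <= k <= n)%N -> F j `<=` F k.
Hypothesis FX : forall k, (k < n)%N -> subfun (F k.+1) (X k.+1).
Hypothesis iX : forall k, (k < n)%N -> intg (X k.+1).
Hypothesis iX2 : forall k, (k < n)%N -> intg (fun x => X k.+1 x ^+ 2).
Hypothesis iX3 : forall k, (k < n)%N -> intg (fun x => `|X k.+1 x| ^+ 3).
Hypothesis X1 : forall k A, (k < n)%N -> F k A -> \int[P]_(x in A) X k.+1 x = 0.
Hypothesis X2 : forall k A, (k < n)%N -> F k A ->
  \int[P]_(x in A) (X k.+1 x ^+ 2 - (r k x - r k.+1 x)) = 0.
Hypothesis X3 : forall k A, (k < n)%N -> F k A ->
  \int[P]_(x in A) (`|X k.+1 x| ^+ 3 - u * X k.+1 x ^+ 2) <= 0.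
(* r k is the conditional variance that remains after time k; it is known
   one step ahead. *)
Hypothesis Fr : forall k, (k < n)%N -> subfun (F k) (r k.+1).
Hypothesis r_0 : forall x, r 0%N x = v ^+ 2.
Hypothesis r_decr : forall k x, (k < n)%N -> 0 <= r k.+1 x <= r k x.
Hypothesis r_step : forall k x, (k < n)%N -> r k x - r k.+1 x <= u ^+ 2.
Hypotheses (u0 : 0 < u) (v0 : 0 < v) (ua : u <= a).

Implicit Types (t m : R) (W f g : T -> R) (k j : nat).

Let a0 : 0 < a. Proof. exact: lt_le_trans ua. Qed.

Lemma SnS k x : S k.+1 x = S k x + X k.+1 x.
Proof. by rewrite /Sn big_nat_recr. Qed.

Lemma Sn_0 x : S 0%N x = 0.
Proof. by rewrite /Sn big_geq. Qed.

Lemma subfun_le j k f : (j <= k)%N -> (k <= n)%N -> subfun (F j) f -> subfun (F k) f.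
Proof.
move=> jk kn; apply: subfunS.
- by apply: sF; exact: leq_trans jk kn.
- exact: sF.
- by apply: FS; rewrite jk kn.
Qed.

Lemma subfun_T k f : (k <= n)%N -> subfun (F k) f -> measurable_fun setT f.
Proof. by move=> kn; apply: subfun_measurable; [exact: sF|exact: FT]. Qed.

Lemma subfun_Sn k : (k <= n)%N -> subfun (F k) (S k).
Proof.
elim: k => [|k ih] kn.
  rewrite (_ : S 0%N = cst 0); first exact: measurable_cst.
  by apply/funext => x; rewrite Sn_0.
rewrite (_ : S k.+1 = (fun x => S k x + X k.+1 x)).
  apply: measurable_funD; last exact: FX.
  by apply: (@subfun_le k) => //; apply: ih; exact: ltnW.
by apply/funext => x; rewrite SnS.
Qed.

Lemma subfun_r k : (k <= n)%N -> subfun (F k) (r k).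
Proof.
case: k => [|k] kn.
  rewrite (_ : r 0%N = cst (v ^+ 2)); first exact: measurable_cst.
  by apply/funext => x; rewrite r_0.
by apply: (@subfun_le k) => //; exact: Fr.
Qed.

Lemma r_ge0 k x : (k <= n)%N -> 0 <= r k x.
Proof.
case: k => [_|k kn]; first by rewrite r_0 sqr_ge0.
by have /andP[] := r_decr x kn.
Qed.

Lemma r_lev2 k x : (k <= n)%N -> r k x <= v ^+ 2.
Proof.
elim: k => [_|k ih kn]; first by rewrite r_0.
have /andP[_] := r_decr x kn; move=> /le_trans; apply; exact/ih/ltnW.
Qed.

Lemma intg_bounded_mul W f m : measurable_fun setT W -> (forall x, 0 <= W x <= m) ->
  intg f -> intg (fun x => W x * f x).
Proof.
move=> mW Wm; apply: (@intgM _ _ _ _ _ _ m) => // x.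
by have /andP[? ?] := Wm x; rewrite ger0_norm.
Qed.

Lemma intg_r k : (k <= n)%N -> intg (r k).
Proof.
move=> kn; apply: (@intg_bounded _ _ _ _ _ (v ^+ 2)).
  exact: subfun_T (subfun_r kn).
by move=> x; rewrite ger0_norm ?r_ge0// r_lev2.
Qed.

Lemma intg_mul_sqr f g : intg f -> intg g -> intg (fun x => f x ^+ 2) ->
  intg (fun x => g x ^+ 2) -> intg (fun x => f x * g x).
Proof.
move=> fi gi f2 g2; apply: (@intg_le _ _ _ _ _ (fun x => f x ^+ 2 + g x ^+ 2)).
- by apply: measurable_funM; exact: intg_measurable P _ _.
- move=> x; rewrite normrM -(real_normK (num_real (f x))).
  rewrite -(real_normK (num_real (g x))).
  have := normr_ge0 (f x); have := normr_ge0 (g x).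
  by have := sqr_ge0 (`|f x| - `|g x|); move: `|f x| `|g x| => y z; nra.
- exact: intgD.
Qed.

Lemma increments k j : (k <= j <= n)%N ->
  intg (fun x => S j x - S k x) /\ intg (fun x => (S j x - S k x) ^+ 2).
Proof.
move=> /andP[+ jn]; elim: j jn => [|j ih] jn.
  rewrite leqn0 => /eqP ->.
  by split; apply: eq_integrable (intg_cst P 0) => // x _; rewrite /= subrr ?expr0n.
rewrite leq_eqVlt => /orP[/eqP <-|].
  by split; apply: eq_integrable (intg_cst P 0) => // x _; rewrite /= subrr ?expr0n.
rewrite ltnS => kj; have [i1 i2] := ih (ltnW jn) kj.
split.
  apply: eq_integrable (intgD i1 (iX jn)) => // x _.
  by rewrite /= SnS addrAC.
apply: eq_integrable (intgD (intgD i2 (intgZ 2 (intg_mul_sqr i1 (iX jn) i2 (iX2 jn))))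
  (iX2 jn)) => // x _.
by rewrite /= SnS; congr EFin; ring.
Qed.

(** Orthogonality of increments given F_k, expressed through weights. In the induction on j the
    cross term has the unbounded weight W (S_j - S_k), hence [cond_eq0]; the square term has the
    bounded weight W. *)
Lemma increment_variance k j W m : (k <= j <= n)%N -> subfun (F k) W ->
  (forall x, 0 <= W x <= m) ->
  \int[P]_x (W x * (S j x - S k x) ^+ 2) = \int[P]_x (W x * (r k x - r j x)).
Proof.
move=> /andP[+ jn] FW Wm; elim: j jn => [|j ih] jn.
  rewrite leqn0 => /eqP ->.
  by apply: eq_Rintegral => x _; rewrite !subrr expr0n.
rewrite leq_eqVlt => /orP[/eqP <-|].
  by apply: eq_Rintegral => x _; rewrite !subrr expr0n.
rewrite ltnS => kj; have jn' := ltnW jn.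
have [i1 i2] := @increments k j (introT andP (conj kj jn')).
have kn := leq_trans kj jn'.
have mW : measurable_fun setT W by exact: subfun_T FW.
have FjW : subfun (F j) W by exact: subfun_le FW.
have Wm' x : `|W x| <= m by have /andP[? ?] := Wm x; rewrite ger0_norm.
have iAX := intg_mul_sqr i1 (iX jn) i2 (iX2 jn).
have irr : intg (fun x => r j x - r j.+1 x) by apply: intgB; exact: intg_r.
have cross : \int[P]_x (W x * (S j x - S k x) * X j.+1 x) = 0.
  apply: (@cond_eq0 _ _ _ P (F j) (sF jn') (FT jn') (fun x => W x * (S j x - S k x))).
  - exact: iX.
  - apply: eq_integrable (intg_bounded_mul mW Wm iAX) => // x _.
    by rewrite /= mulrA.
  - by move=> A; exact: X1.
  - apply: measurable_funM => //; apply: measurable_funB; first exact: subfun_Sn.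
    by apply: (@subfun_le k) => //; exact: subfun_Sn.
have sq : \int[P]_x (W x * (X j.+1 x ^+ 2 - (r j x - r j.+1 x))) = 0.
  apply: (@cond_eq0_bounded _ _ _ P (F j) (sF jn') (FT jn') W _ m) => //.
  - by apply: intgB => //; exact: iX2.
  - by move=> A; exact: X2.
transitivity (\int[P]_x (W x * (S j x - S k x) ^+ 2
    + 2 * (W x * (S j x - S k x) * X j.+1 x)
    + W x * (X j.+1 x ^+ 2 - (r j x - r j.+1 x)) + W x * (r j x - r j.+1 x))).
  by apply: eq_Rintegral => x _; rewrite SnS; ring.
have iA : intg (fun x => W x * (S j x - S k x) ^+ 2) by exact: intg_bounded_mul Wm i2.
have iB : intg (fun x => 2 * (W x * (S j x - S k x) * X j.+1 x)).
  apply: intgZ; apply: eq_integrable (intg_bounded_mul mW Wm iAX) => // x _.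
  by rewrite /= mulrA.
have iC : intg (fun x => W x * (X j.+1 x ^+ 2 - (r j x - r j.+1 x))).
  by apply: (intg_bounded_mul mW Wm); apply: intgB => //; exact: iX2.
have iD : intg (fun x => W x * (r j x - r j.+1 x)) by exact: intg_bounded_mul Wm irr.
have iE : intg (fun x => W x * (r k x - r j x)).
  by apply: (intg_bounded_mul mW Wm); apply: intgB; exact: intg_r.
rewrite !ExD//; [|exact: intgD|by apply: intgD => //; exact: intgD].
rewrite sq addr0 (_ : \int[P]_x (2 * _) = 0) ?addr0; last first.
  rewrite ExZ ?cross ?mulr0//.
  by apply: eq_integrable (intg_bounded_mul mW Wm iAX) => // x _; rewrite /= mulrA.
rewrite (ih jn' kj) -ExD//.
by apply: eq_Rintegral => x _; ring.
Qed.

Local Notation L := (fun k x => a ^+ 2 + r k x).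
Local Notation rt k x := (Num.sqrt (a ^+ 2 + r k x)).

Lemma L_gt0 k x : (k <= n)%N -> 0 < L k x.
Proof. by move=> kn; rewrite ltr_wpDr ?r_ge0// exprn_gt0. Qed.

Lemma rt_ge k x : (k <= n)%N -> a <= rt k x.
Proof.
move=> kn; rewrite -{1}(ger0_norm (ltW a0)) -sqrtr_sqr ler_wsqrtr//.
by rewrite lerDl r_ge0.
Qed.

Lemma rt_gt0 k x : (k <= n)%N -> 0 < rt k x.
Proof. by move=> kn; apply: lt_le_trans (rt_ge x kn). Qed.

Lemma subfun_rt k : (k < n)%N -> subfun (F k) (fun x => rt k.+1 x).
Proof.
by move=> kn; apply: measurable_fun_sqrt; apply: measurable_funD => //; exact: Fr.
Qed.

Lemma subfun_rtV k : (k < n)%N -> subfun (F k) (fun x => (rt k.+1 x)^-1).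
Proof.
move=> kn; apply: (measurable_fun_inv a0); last exact: subfun_rt.
by move=> x; exact: rt_ge.
Qed.

Lemma subfun_ratio k j t : (k < n)%N -> (j <= k)%N ->
  subfun (F k) (fun x => (t - S j x) / rt k.+1 x).
Proof.
move=> kn jk; apply: measurable_funM; last exact: subfun_rtV.
apply: measurable_funB => //; apply: (@subfun_le j) => //; first exact: ltnW.
by apply: subfun_Sn; exact: leq_trans jk (ltnW kn).
Qed.

Lemma measurable_ratio k j t : (k < n)%N -> (j <= n)%N ->
  measurable_fun setT (fun x => (t - S j x) / rt k.+1 x).
Proof.
move=> kn jn; apply: measurable_funM.
  by apply: measurable_funB => //; apply: (subfun_T jn); exact: subfun_Sn.
by apply: (subfun_T (ltnW kn)); exact: subfun_rtV.
Qed.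

Lemma rtV_le k x : (k <= n)%N -> 0 <= (rt k x)^-1 <= a^-1.
Proof.
move=> kn; rewrite invr_ge0 (ltW (rt_gt0 _ kn))/=.
by rewrite lef_pV2 ?posrE ?rt_gt0 ?rt_ge.
Qed.

Lemma bounded_mul W f m m' : (forall x, 0 <= W x <= m) -> (forall x, 0 <= f x <= m') ->
  forall x, 0 <= W x * f x <= m * m'.
Proof.
move=> Wm fm x; have /andP[? ?] := Wm x; have /andP[? ?] := fm x.
by rewrite mulr_ge0//= ler_pM.
Qed.

Lemma cauchy_bounded (x : R) : 0 <= cauchy x <= 1.
Proof. by rewrite (ltW (cauchy_gt0 _)) cauchy_le1. Qed.

(* Jensen's inequality for 1 / (1 + z^2) under the conditional law of S_n: the
   tangent to w |-> 1 / w at w = 3 (1 + x^2) bounds cauchy from below by a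
   quadratic, whose expectation is controlled by the remaining variance. *)
Lemma expectation_cauchy_terminal k t W m : (k < n)%N -> subfun (F k) W ->
  (forall x, 0 <= W x <= m) ->
  \int[P]_x (W x * cauchy ((t - S k x) / rt k.+1 x)) <=
  3 * \int[P]_x (W x * cauchy ((t - S n x) / rt k.+1 x)).
Proof.
move=> kn FW Wm; have kn' := ltnW kn.
have mW := subfun_T kn' FW.
pose c x := cauchy ((t - S k x) / rt k.+1 x).
pose V x := W x * (c x ^+ 2 * (rt k.+1 x)^-1 ^+ 2).
have Fc : subfun (F k) c by apply: measurable_fun_cauchy; exact: subfun_ratio.
have FV : subfun (F k) V.
  apply: measurable_funM => //; apply: measurable_funM.
    exact: measurable_funX.
  by apply: measurable_funX; exact: subfun_rtV.
have Vm x : 0 <= V x <= m * (1 * a^-1 ^+ 2).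
  move: x; apply: (@bounded_mul W) => // x.
  move: x; apply: (@bounded_mul (fun x => c x ^+ 2)) => z.
    by have /andP[c0 c1] := cauchy_bounded ((t - S k z) / rt k.+1 z); rewrite sqr_ge0 expr_le1.
  by have /andP[c0 c1] := rtV_le z kn; rewrite sqr_ge0/= lerXn2r ?nnegrE// invr_ge0 ltW.
have iW j : (j <= n)%N -> intg (fun x => W x * cauchy ((t - S j x) / rt k.+1 x)).
  move=> jn; have mc : measurable_fun setT (fun x => cauchy ((t - S j x) / rt k.+1 x)).
    by apply: measurable_fun_cauchy; exact: measurable_ratio.
  apply: (intg_bounded_mul mW Wm); apply: (@intg_bounded _ _ _ _ _ 1) => // x.
  by have /andP[? ?] := cauchy_bounded ((t - S j x) / rt k.+1 x); rewrite ger0_norm.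
have [_ i2] := @increments k n (introT andP (conj kn' (leqnn n))).
have mV := subfun_T kn' FV.
have iV1 : intg (fun x => V x * (S n x - S k x) ^+ 2) by exact: intg_bounded_mul Vm i2.
have iV2 : intg (fun x => V x * (r k x - r n x)).
  by apply: (intg_bounded_mul mV Vm); apply: intgB; exact: intg_r.
have := @increment_variance k n V _ (introT andP (conj kn' (leqnn n))) FV Vm.
move=> eV.
(* A term of mean zero by [increment_variance] is added; with it the inequality holds pointwise. *)
have -> : 3 * \int[P]_x (W x * cauchy ((t - S n x) / rt k.+1 x)) =
  \int[P]_x (3 * (W x * cauchy ((t - S n x) / rt k.+1 x)) +
    2 / 3 * (V x * (S n x - S k x) ^+ 2 - V x * (r k x - r n x))).
  rewrite ExD; [|by apply: intgZ; exact: iW|by apply: intgZ; exact: intgB].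
  rewrite !ExZ; [|exact: intgB|exact: iW].
  by rewrite ExB// eV subrr mulr0 addr0.
apply: Ex_le; first exact: iW.
  by apply: intgD; apply: intgZ; [exact: iW|exact: intgB].
move=> x.
have rtx := rt_gt0 x kn; have Lx := L_gt0 x kn.
(* The step variance is at most u^2 <= a^2, so the variance remaining from time k is at most 1 in
   units of [L k.+1]. *)
have rk : r k x <= L k.+1 x.
  have := r_step x kn; have : u ^+ 2 <= a ^+ 2 by rewrite lerXn2r ?nnegrE ?(ltW u0) ?(ltW a0).
  lra.
have rn := r_ge0 x (leqnn n).
have /andP[W0 _] := Wm x.
rewrite -mulrBr /V; set y := (S n x - S k x) / rt k.+1 x.
have hV : (c x) ^+ 2 * (rt k.+1 x)^-1 ^+ 2 * ((S n x - S k x) ^+ 2 - (r k x - r n x))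
    >= c x ^+ 2 * (y ^+ 2 - 1).
  rewrite -mulrA ler_wpM2l ?sqr_ge0// mulrBr /y expr_div_n exprVn mulrC lerB//.
  rewrite sqr_sqrtr ?(ltW Lx)// mulrC ler_pdivrMr// mul1r.
  by have := sF (leqnn n); lra.
have e : (t - S n x) / rt k.+1 x = (t - S k x) / rt k.+1 x - y.
  by rewrite /y -mulrBl; congr (_ / _); ring.
have cy : c x <= 3 * cauchy ((t - S n x) / rt k.+1 x) + 2 / 3 * (c x ^+ 2 * (y ^+ 2 - 1)).
  rewrite e /c; move: ((t - S k x) / rt k.+1 x) => z.
  have hz := cauchyK z; have hzy := cauchyK (z - y).
  have := cauchy_gt0 z; have := cauchy_gt0 (z - y); have := cauchy_le1 z.
  set p := cauchy z in hz *; set q := cauchy (z - y) in hzy *.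
  move=> p1 q0 p0.
  (* This is the tangent at w = 3 / p. The factor 3 comes from 1 + (z - y)^2 <= 1 + 2 z^2 + 2 y^2:
     when y^2 has mean at most 1, the mean is at most 3 (1 + z^2). *)
  have t1 : 2 * p / 3 - (p / 3) ^+ 2 * (1 + (z - y) ^+ 2) <= q.
    rewrite -subr_ge0 (_ : q - _ = q * (1 - (p / 3) * (1 + (z - y) ^+ 2)) ^+ 2).
      by rewrite mulr_ge0 ?sqr_ge0// ltW.
    set w := 1 + (z - y) ^+ 2 in hzy *.
    rewrite (_ : q * _ ^+ 2 = q - 2 * (p / 3) * (q * w) + (p / 3) ^+ 2 * (q * w) * w).
      by rewrite hzy; field.
    by field.
  have t2 : p ^+ 2 * (1 + (z - y) ^+ 2) <= p ^+ 2 * (1 + 2 * z ^+ 2 + 2 * y ^+ 2).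
    rewrite ler_wpM2l ?sqr_ge0// -subr_ge0.
    have -> : 1 + 2 * z ^+ 2 + 2 * y ^+ 2 - (1 + (z - y) ^+ 2) = (z + y) ^+ 2 by ring.
    exact: sqr_ge0.
  have t3 : p ^+ 2 * (1 + 2 * z ^+ 2) = 2 * p - p ^+ 2.
    transitivity (2 * p * (p * (1 + z ^+ 2)) - p ^+ 2); first by ring.
    by rewrite hz; ring.
  have t4 : p ^+ 2 <= p by rewrite expr2 ler_piMl// ltW.
  move: t1 t2 t3 t4; rewrite expr_div_n mulrDr (mulrBr (p ^+ 2)).
  set P2 := p ^+ 2; set Y2 := y ^+ 2; set Z2 := (z - y) ^+ 2; nra.
rewrite -/(c x) [3 * _]mulrCA [2 / 3 * _]mulrCA -mulrA -mulrDr ler_wpM2l//.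
apply: (le_trans cy); rewrite lerD2l [leRHS]mulrCA.
by apply: ler_wpM2l; first by rewrite divr_ge0.
Qed.

Lemma subfun_L k : (k < n)%N -> subfun (F k) (fun x => L k.+1 x).
Proof. by move=> kn; apply: measurable_funD => //; exact: Fr. Qed.

Lemma integrable_Phi_ratio t k : (k <= n)%N ->
  intg (fun x => Phi ((t - S k x) / rt k x)).
Proof.
move=> kn; apply: (@intg_bounded _ _ _ _ _ 1).
  apply: measurable_fun_Phi; apply: measurable_funM.
    by apply: measurable_funB => //; apply: (subfun_T kn); exact: subfun_Sn.
  apply: (measurable_fun_inv a0); first by move=> x; exact: rt_ge.
  apply: measurable_fun_sqrt; apply: measurable_funD => //.
  by apply: (subfun_T kn); exact: subfun_r.
by move=> x; rewrite ger0_norm ?Phi_ge0 ?Phi_le1.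
Qed.

Section expansion.
Variable K : R.
Hypothesis K0 : 0 < K.
Hypothesis expansion : forall b l s u y : R,
  0 <= u -> u ^+ 2 <= l -> 0 < l -> 0 <= s <= u ^+ 2 ->
  `|Phi ((b - y) / Num.sqrt l) - Phi (b / Num.sqrt (l + s))
    + phi (b / Num.sqrt l) / Num.sqrt l * y
    - - (b / Num.sqrt l) * phi (b / Num.sqrt l) / (2 * l) * (y ^+ 2 - s)|
  <= K * (cauchy (b / Num.sqrt l) / Num.sqrt l ^+ 3 * (`|y| ^+ 3 + u * s)).

(** Since [L k.+1] is known at time k, the coefficients of X_(k+1) and of X_(k+1)^2 - s are bounded
    weights measurable for F_k, and these terms have mean zero. Of the remainder, [X3] trades |X|^3
    for u X^2, and [X2] trades X^2 for the conditional variance. *)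
Lemma lindeberg_step t k : (k < n)%N ->
  `|\int[P]_x Phi ((t - S k.+1 x) / rt k.+1 x) - \int[P]_x Phi ((t - S k x) / rt k x)|
  <= 2 * K * u * \int[P]_x (cauchy ((t - S k x) / rt k.+1 x) / rt k.+1 x ^+ 3
                            * (r k x - r k.+1 x)).
Proof.
move=> kn; have kn' := ltnW kn.
pose z x := (t - S k x) / rt k.+1 x.
pose W1 x := phi (z x) / rt k.+1 x.
pose W2 x := - z x * phi (z x) / (2 * L k.+1 x).
pose C3 x := cauchy (z x) / rt k.+1 x ^+ 3.
pose s x := r k x - r k.+1 x.
have Fz : subfun (F k) z by exact: subfun_ratio.
have FW1 : subfun (F k) W1.
  by apply: measurable_funM; [exact: measurable_fun_phi|exact: subfun_rtV].
have W1m x : `|W1 x| <= 1 * a^-1.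
  have /andP[? ?] := rtV_le x kn; rewrite normrM !ger0_norm ?phi_ge0//.
  rewrite ler_pM ?phi_ge0//; apply: le_trans normal_peak1_le1.
  exact: normal_pdf_ub.
have aL x : 2 * a ^+ 2 <= 2 * L k.+1 x by rewrite ler_pM2l// lerDl r_ge0.
have a2 : 0 < 2 * a ^+ 2 by rewrite mulr_gt0 ?exprn_gt0.
have FW2 : subfun (F k) W2.
  apply: measurable_funM.
    by apply: measurable_funM; [exact: measurableT_comp|exact: measurable_fun_phi].
  apply: (measurable_fun_inv a2) => //.
  by apply: measurable_funM => //; exact: subfun_L.
have W2m x : `|W2 x| <= 108 / (2 * a ^+ 2).
  rewrite normrM; apply: ler_pM => //.
    apply: (le_trans (dphi_bound _)); have := cauchy_le1 (z x); lra.
  rewrite ger0_norm ?lef_pV2 ?posrE//; first exact: lt_le_trans (aL x).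
  by rewrite invr_ge0 (le_trans _ (aL x))// ltW.
have FC3 : subfun (F k) C3.
  apply: measurable_funM; first exact: measurable_fun_cauchy.
  apply: (@measurable_fun_inv _ _ _ _ (a ^+ 3)).
  - by rewrite exprn_gt0.
  - by move=> x; rewrite lerXn2r ?nnegrE ?rt_ge// ltW// rt_gt0.
  - by apply: measurable_funX; exact: subfun_rt.
have C3m x : 0 <= C3 x <= 1 * (a ^+ 3)^-1.
  have rt3 : 0 < rt k.+1 x ^+ 3 by rewrite exprn_gt0 ?rt_gt0.
  have /andP[c0 c1] := cauchy_bounded (z x).
  apply/andP; split; first by rewrite divr_ge0// ltW.
  apply: ler_pM; [by []|by rewrite invr_ge0 ltW|by []|].
  have art : a ^+ 3 <= rt k.+1 x ^+ 3.
    by rewrite lerXn2r ?nnegrE ?rt_ge ?(ltW a0) ?(ltW (rt_gt0 _ kn)).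
  by rewrite lef_pV2 ?posrE// exprn_gt0.
have mC3 := subfun_T kn' FC3.
have is_ : intg s by apply: intgB; exact: intg_r.
have i1 := iX kn; have i2 := iX2 kn; have i3 := iX3 kn.
have i2s : intg (fun x => X k.+1 x ^+ 2 - s x) by exact: intgB.
have i3s : intg (fun x => `|X k.+1 x| ^+ 3 - u * X k.+1 x ^+ 2).
  by apply: intgB => //; exact: intgZ.
have e1 : \int[P]_x (W1 x * X k.+1 x) = 0.
  by apply: (cond_eq0_bounded (sF kn') (FT kn') i1 _ FW1 W1m) => A; exact: X1.
have e2 : \int[P]_x (W2 x * (X k.+1 x ^+ 2 - s x)) = 0.
  by apply: (cond_eq0_bounded (sF kn') (FT kn') i2s _ FW2 W2m) => A; exact: X2.
have e2' : \int[P]_x (C3 x * (X k.+1 x ^+ 2 - s x)) = 0.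
  have C3m' x : `|C3 x| <= 1 * (a ^+ 3)^-1.
    by have /andP[c0 c1] := C3m x; rewrite ger0_norm.
  by apply: (cond_eq0_bounded (sF kn') (FT kn') i2s _ FC3 C3m') => A; exact: X2.
have e3 : \int[P]_x (C3 x * (`|X k.+1 x| ^+ 3 - u * X k.+1 x ^+ 2)) <= 0.
  by apply: (cond_le0 (sF kn') (FT kn') i3s _ FC3 C3m) => A; exact: X3.
have iW1 : intg (fun x => W1 x * X k.+1 x).
  by apply: intgM W1m i1; exact: subfun_T FW1.
have iW2 : intg (fun x => W2 x * (X k.+1 x ^+ 2 - s x)).
  by apply: intgM W2m i2s; exact: subfun_T FW2.
have iP1 := integrable_Phi_ratio t kn; have iP0 := integrable_Phi_ratio t kn'.
(* The mean-zero terms are inserted so that the integrand becomes the left-hand side of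
   [expansion]. *)
rewrite -ExB// -[X in `|X|]addr0 -[X in `|_ + X|]e1 -[X in `|X|]subr0 -[X in `|_ - X|]e2.
have iB1 := intgB iP1 iP0; have iB2 := intgD iB1 iW1.
rewrite -ExD// -ExB//.
apply: le_trans (Ex_norm (intgB iB2 iW2)) _.
have iC (c : R) f : intg f -> intg (fun x => c * (C3 x * f x)).
  by move=> fi; apply: intgZ; exact: intg_bounded_mul mC3 C3m fi.
have iCa := iC K _ i3s; have iCb := iC (K * u) _ i2s; have iCc := iC (2 * K * u) _ is_.
(* |X|^3 + u s = (|X|^3 - u X^2) + u (X^2 - s) + 2 u s: against [C3], the first part has nonpositive
   integral, the second has integral zero, and only the third survives. *)
apply: (@le_trans _ _ (\int[P]_x (K * (C3 x * (`|X k.+1 x| ^+ 3 - u * X k.+1 x ^+ 2))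
    + K * u * (C3 x * (X k.+1 x ^+ 2 - s x)) + 2 * K * u * (C3 x * s x)))).
  apply: Ex_le.
  - exact/intg_norm/(intgB iB2 iW2).
  - by apply: intgD => //; exact: intgD.
  move=> x; rewrite (_ : _ + _ + _ = K * (C3 x * (`|X k.+1 x| ^+ 3 + u * s x))); last first.
    by ring.
  rewrite /W1 /W2 /C3 /z SnS.
  have -> : a ^+ 2 + r k x = L k.+1 x + s x by rewrite /s; ring.
  have -> : (t - (S k x + X k.+1 x)) = (t - S k x) - X k.+1 x by ring.
  apply: expansion; first exact: ltW.
  - apply: (@le_trans _ _ (a ^+ 2)); last by rewrite lerDl r_ge0.
    by rewrite lerXn2r ?nnegrE ?(ltW u0) ?(ltW a0).
  - exact: L_gt0.
  - by rewrite /s subr_ge0 r_step// andbT; have /andP[] := r_decr x kn.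
have iCs : intg (fun x => C3 x * s x) by exact: intg_bounded_mul mC3 C3m is_.
have iC2 : intg (fun x => C3 x * (X k.+1 x ^+ 2 - s x)).
  exact: intg_bounded_mul mC3 C3m i2s.
have iC3 : intg (fun x => C3 x * (`|X k.+1 x| ^+ 3 - u * X k.+1 x ^+ 2)).
  exact: intg_bounded_mul mC3 C3m i3s.
rewrite ExD ?ExD//; last exact: intgD.
rewrite !ExZ// e2' mulr0 addr0 gerDr.
by rewrite pmulr_rle0.
Qed.

(** The factor 6 is 2 from [lindeberg_step] times 3 from [expectation_cauchy_terminal]. The scale
    2^i a contributes 8 / (2^i a) times 16 D + 25 * 2^(i+1) a / v, that is 128 * 2^-i D / a + 400 /
    v: the first part is geometric, the second is counted p times. *)
Lemma lindeberg_sum t p D : a ^+ 2 + v ^+ 2 < (2 ^+ p * a) ^+ 2 ->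
  (forall t, `|fine (P [set x | S n x <= t]) - Phi (t / v)| <= D) ->
  `|\int[P]_x Phi ((t - S n x) / rt n x) - Phi (t / Num.sqrt (a ^+ 2 + v ^+ 2))|
  <= 6 * K * u * (256 * (D / a) + 400 * (p%:R / v)).
Proof.
move=> hp hD.
pose f (k : nat) := \int[P]_x Phi ((t - S k x) / rt k x).
have -> : Phi (t / Num.sqrt (a ^+ 2 + v ^+ 2)) = f 0%N.
  rewrite -(Ex_cst P (Phi _)); apply: eq_Rintegral => x _.
  by rewrite Sn_0 subr0 r_0.
have {1}-> : \int[P]_x Phi ((t - S n x) / rt n x) = f n by [].
have -> : f n - f 0%N = \sum_(k < n) (f k.+1 - f k).
  by have := @telescope_sumr R 0 n f (leq0n n); rewrite big_mkord => ->.
apply: le_trans (ler_norm_sum _ _ _) _.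
pose g (k : nat) x := (r k x - r k.+1 x) * (rt k.+1 x ^+ 3)^-1 *
  cauchy ((t - S n x) / rt k.+1 x).
have K6 : 0 <= 6 * K * u by have := mulr_gt0 K0 u0; lra.
have iWm k : (k < n)%N -> exists2 m, subfun (F k)
    (fun x => (r k x - r k.+1 x) * (rt k.+1 x ^+ 3)^-1) &
    (forall x, 0 <= (r k x - r k.+1 x) * (rt k.+1 x ^+ 3)^-1 <= m).
  move=> kn; exists (u ^+ 2 * (a ^+ 3)^-1).
    apply: measurable_funM.
      by apply: measurable_funB; [exact: subfun_r (ltnW kn)|exact: Fr].
    apply: (@measurable_fun_inv _ _ _ _ (a ^+ 3)).
    - by rewrite exprn_gt0.
    - by move=> x; rewrite lerXn2r ?nnegrE ?rt_ge ?(ltW a0) ?(ltW (rt_gt0 _ kn)).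
    - by apply: measurable_funX; exact: subfun_rt.
  apply: bounded_mul => x.
    by rewrite r_step// andbT subr_ge0; have /andP[] := r_decr x kn.
  have rt3 : 0 < rt k.+1 x ^+ 3 by rewrite exprn_gt0 ?rt_gt0.
  rewrite invr_ge0 (ltW rt3)/= lef_pV2 ?posrE ?exprn_gt0 ?(rt_gt0 _ kn)//.
  by rewrite lerXn2r ?nnegrE ?rt_ge ?(ltW a0) ?(ltW (rt_gt0 _ kn)).
have ig k : (k < n)%N -> intg (g k).
  move=> kn; have [m FW Wm] := iWm k kn; have mW := subfun_T (ltnW kn) FW.
  have mc : measurable_fun setT (fun x => cauchy ((t - S n x) / rt k.+1 x)).
    by apply: measurable_fun_cauchy; exact: measurable_ratio.
  apply: (intg_bounded_mul mW Wm); apply: (@intg_bounded _ _ _ _ _ 1) => // x.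
  by have /andP[? ?] := cauchy_bounded ((t - S n x) / rt k.+1 x); rewrite ger0_norm.
have mSn : measurable_fun setT (S n) by apply: (subfun_T (leqnn n)); exact: subfun_Sn.
pose c (i : nat) x := 8 / (2 ^+ i * a) * cauchy ((t - S n x) / (2 ^+ i.+1 * a)).
have ica (i : nat) : intg (fun x => cauchy ((t - S n x) / (2 ^+ i.+1 * a))).
  apply: (@intg_bounded _ _ _ _ _ 1).
    apply: measurable_fun_cauchy; apply: measurable_funM => //.
    exact: measurable_funB.
  move=> x; have /andP[? ?] := cauchy_bounded ((t - S n x) / (2 ^+ i.+1 * a)).
  by rewrite ger0_norm.
have ic (i : nat) : intg (c i) by apply: intgZ; exact: ica.
have step1 : \sum_(k < n) `|f k.+1 - f k| <= 6 * K * u * \int[P]_x (\sum_(k < n) g k x).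
  rewrite (Ex_sum ig) mulr_sumr; apply: ler_sum => k _.
  apply: le_trans (lindeberg_step t (ltn_ord k)) _.
  have [m FW Wm] := iWm k (ltn_ord k).
  have := expectation_cauchy_terminal t (ltn_ord k) FW Wm.
  have -> : 6 * K * u * Ex (g k) = 2 * K * u * (3 * Ex (g k)) by ring.
  move=> h; rewrite ler_pM2l ?mulr_gt0//; apply: le_trans h.
  by rewrite le_eqVlt; apply/orP; left; apply/eqP/eq_Rintegral => x _; ring.
apply: (le_trans step1); rewrite ler_wpM2l//.
have step2 : \int[P]_x (\sum_(k < n) g k x) <= \int[P]_x (\sum_(i < p) c i x).
  apply: Ex_le; [exact: intg_sum|by apply: (intg_sum (f := c)) => i _|move=> x].
  apply: le_trans (@sum_cauchy_scales R n p a (t - S n x) (fun k => L k x) a0 _ _ _).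
  - rewrite le_eqVlt; apply/orP; left; apply/eqP/eq_bigr => k _.
    by rewrite /g; congr (_ * _ * _); ring.
  - by move=> k kn; rewrite lerDl r_ge0.
  - move=> k kn; rewrite (_ : L k x - L k.+1 x = r k x - r k.+1 x); last by ring.
    have /andP[_ h] := r_decr x kn; rewrite subr_ge0 h (le_trans (r_step x kn))//.
    by rewrite lerXn2r ?nnegrE ?(ltW u0) ?(ltW a0).
  - by move=> k kn; apply: le_lt_trans hp; rewrite lerD2l r_lev2.
apply: (le_trans step2); rewrite (Ex_sum (f := c)); last by move=> i _.
apply: (@le_trans _ _ (\sum_(i < p) (128 * (D / a) * (1 / 2) ^+ i + 400 / v))).
  apply: ler_sum => i _; rewrite ExZ; last exact: ica.
  have ci : 0 < 2 ^+ i * a by rewrite mulr_gt0 ?exprn_gt0.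
  have := @expectation_cauchy_le _ _ _ P (S n) v D mSn v0 hD t (2 ^+ i.+1 * a).
  rewrite mulr_gt0 ?exprn_gt0// => /(_ isT) h.
  apply: (@le_trans _ _ (8 / (2 ^+ i * a) * (16 * D + 25 * (2 ^+ i.+1 * a / v)))).
    by apply: ler_wpM2l h; rewrite divr_ge0 ?(ltW ci).
  rewrite exprS expr_div_n expr1n le_eqVlt; apply/orP; left; apply/eqP.
  by field; rewrite !gt_eqF ?exprn_gt0.
rewrite big_split/= sumr_const card_ord -mulr_sumr -mulr_natr.
have := @geometric_sum_le2 R p (1 / 2).
have D0 : 0 <= D / a by rewrite divr_ge0 ?(ltW a0)// (le_trans _ (hD 0)).
set s := \sum_(j < p) _ => hs.
have {}hs : s <= 2 by apply: hs; apply/andP; split; lra.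
have : D / a * s <= D / a * 2 by rewrite ler_wpM2l.
lra.
Qed.

Hypothesis r_n : {ae P, forall x, r n x = 0}.

(** As r_n vanishes almost surely, the final smoothing has exactly the scale a. At the other end,
    replacing the variance a^2 + v^2 by v^2 costs 54 (a / v)^2, which is at most 54 a / v because a
    <= v. *)
Lemma smooth_distance t p D : a <= v -> a ^+ 2 + v ^+ 2 < (2 ^+ p * a) ^+ 2 ->
  (forall t, `|fine (P [set x | S n x <= t]) - Phi (t / v)| <= D) ->
  `|\int[P]_x Phi ((t - S n x) / a) - Phi (t / v)|
  <= 6 * K * u * (256 * (D / a) + 400 * (p%:R / v)) + 54 * (a / v).
Proof.
move=> av hp hD; have h := lindeberg_sum t hp hD.
have -> : \int[P]_x Phi ((t - S n x) / a) = \int[P]_x Phi ((t - S n x) / rt n x).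
  apply: Ex_ae.
  - apply: measurable_fun_Phi; apply: measurable_funM => //.
    by apply: measurable_funB => //; apply: (subfun_T (leqnn n)); exact: subfun_Sn.
  - exact: intg_measurable (integrable_Phi_ratio t (leqnn n)).
  - by apply: filterS r_n => x ->; rewrite addr0 sqrtr_sqr (ger0_norm (ltW a0)).
have v2 : 0 < v ^+ 2 by rewrite exprn_gt0.
have := Phi_var_lip t v2 (sqr_ge0 a).
rewrite sqrtr_sqr (gtr0_norm v0) (addrC (v ^+ 2)) => h2.
apply: le_trans (ler_distD (Phi (t / Num.sqrt (a ^+ 2 + v ^+ 2))) _ _) _.
apply: lerD => //; apply: (le_trans h2).
have av1 : a / v <= 1 by rewrite ler_pdivrMr// mul1r.
have av0 : 0 <= a / v by rewrite divr_ge0 ?(ltW a0) ?(ltW v0).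
have e : a ^+ 2 / v ^+ 2 = (a / v) ^+ 2 by rewrite expr_div_n.
have : (a / v) ^+ 2 <= a / v by rewrite expr2 ler_piMl.
rewrite e; lra.
Qed.

(** D enters twice on the right: with coefficient 6 * 256 K / M from the Lindeberg sum and 72 * 16 /
    c from the smoothing. Each is at most 1/4, which leaves D / 2. *)
Lemma self_improvement t p M c D : 1 <= c -> 72 * 16 <= c / 4 ->
  6 * 256 * K <= M / 4 -> a = M * u ->
  a <= v -> a ^+ 2 + v ^+ 2 < (2 ^+ p * a) ^+ 2 ->
  (forall t, `|fine (P [set x | S n x <= t]) - Phi (t / v)| <= D) ->
  `|fine (P [set x | S n x <= t]) - Phi (t / v)|
  <= D / 2 + (6 * 400 * K + M * (54 + c + 72 * 25)) * (1 + p%:R) * (u / v).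
Proof.
move=> c1 c2 KM aM av hp hD.
have D0 : 0 <= D by apply: le_trans (hD 0).
have mS : measurable_fun setT (S n) by apply: (subfun_T (leqnn n)); exact: subfun_Sn.
have := @smoothing _ _ _ P (S n) v D mS v0 hD a c _ t a0 c1
  (fun t => smooth_distance t av hp hD).
move=> /le_trans; apply.
have M0 : 0 < M by have := a0; rewrite aM pmulr_lgt0.
have c0 : 0 < c by lra.
have av0 : 0 <= a / v by rewrite divr_ge0 ?(ltW a0) ?(ltW v0).
have uv0 : 0 <= u / v by rewrite divr_ge0 ?(ltW u0) ?(ltW v0).
have avM : a / v = M * (u / v) by rewrite aM mulrA.
have t1 : 6 * K * u * (256 * (D / a)) <= D / 4.
  rewrite (_ : 6 * K * u * _ = 6 * 256 * K / M * D); last first.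
    by rewrite aM; field; rewrite !gt_eqF.
  rewrite mulrC ler_wpM2l// ler_pdivrMr//; lra.
have t2 : 72 / c * (16 * D) <= D / 4.
  rewrite (_ : 72 / c * _ = 72 * 16 / c * D); last by ring.
  rewrite mulrC ler_wpM2l// ler_pdivrMr//; lra.
have t3 : 72 / c * (25 * (a / v)) <= 72 * (25 * (a / v)).
  apply: ler_wpM2r; first by apply: mulr_ge0; [exact: ler0n|].
  by rewrite ler_pdivrMr//; lra.
have K60 : 0 <= 6 * 400 * K by have := K0; lra.
have Mc0 : 0 <= M * (54 + c + 72 * 25).
  by apply: mulr_ge0; [exact: ltW|lra].
have t5 := mulr_ge0 K60 uv0.
have t6 := mulr_ge0 (mulr_ge0 Mc0 (ler0n R p)) uv0.
have -> : (6 * 400 * K + M * (54 + c + 72 * 25)) * (1 + p%:R) * (u / v) =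
   6 * 400 * K * (u / v) + 6 * 400 * K * p%:R * (u / v) +
   54 * (M * (u / v)) + c * (M * (u / v)) + 72 * (25 * (M * (u / v))) +
   M * (54 + c + 72 * 25) * p%:R * (u / v) by ring.
have -> : 6 * K * u * (256 * (D / a) + 400 * (p%:R / v)) =
    6 * K * u * (256 * (D / a)) + 6 * 400 * K * p%:R * (u / v) by ring.
have -> : 72 / c * (16 * D + 25 * (a / v)) =
    72 / c * (16 * D) + 72 / c * (25 * (a / v)) by ring.
move: t1 t2 t3 t5 t6; rewrite avM.
move: (M * (54 + c + 72 * 25) * p%:R * (u / v)) (6 * 400 * K * p%:R * (u / v)).
move: (6 * 400 * K * (u / v)) (6 * K * u * (256 * (D / a))).
move: (72 / c * (16 * D)) (72 / c * (25 * (M * (u / v)))) (c * (M * (u / v))).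
by move=> *; lra.
Qed.

End expansion.

(** The n step variances are at most u^2 and exhaust v^2; integration turns the almost sure
    statement into one about numbers. It limits the number of dyadic scales between u and v. *)
Lemma v_le_u : {ae P, forall x, r n x = 0} -> v ^+ 2 <= n%:R * u ^+ 2.
Proof.
move=> rn0; have h k x : (k <= n)%N -> v ^+ 2 <= r k x + k%:R * u ^+ 2.
  elim: k => [_|k ih kn]; first by rewrite r_0 mul0r addr0.
  have := ih (ltnW kn); have := r_step x kn; rewrite -natr1; lra.
have irn := intg_r (leqnn n).
have -> : n%:R * u ^+ 2 = Ex (r n) + n%:R * u ^+ 2.
  rewrite (@Ex_ae _ _ _ P (r n) (cst 0)) ?Ex_cst ?add0r//.
  exact: intg_measurable irn.
rewrite -[leLHS](Ex_cst P) -[X in _ + X](Ex_cst P) -ExD//; last exact: intg_cst.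
apply: Ex_le; [exact: intg_cst|by apply: intgD => //; exact: intg_cst|].
by move=> x; exact: h.
Qed.

End martingale.

(** * The class M_n(gamma) *)

Section remaining_variance.
Context {T : Type} {R : realType}.
Implicit Types (tot cap y : R) (sg : nat -> T -> R).

Definition clip cap y := Num.min (Num.max y 0) cap.

(* Truncation makes the bounds on conditional variances hold everywhere and
   not only almost surely. *)
Definition remaining tot cap sg (k : nat) (x : T) : R :=
  Num.max 0 (tot - \sum_(1 <= i < k.+1) clip cap (sg i x)).

Lemma clip_itv cap y : 0 <= cap -> 0 <= clip cap y <= cap.
Proof.
by move=> u0; rewrite /clip le_min le_max lexx orbT u0/= ge_min lexx orbT.
Qed.

Lemma clip_id cap y : 0 <= y <= cap -> clip cap y = y.
Proof. by move=> /andP[y0 yu]; rewrite /clip max_l// min_l. Qed.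

Lemma remaining0 tot cap sg x : 0 <= tot -> remaining tot cap sg 0 x = tot.
Proof. by move=> v0; rewrite /remaining big_geq// subr0 max_r. Qed.

Lemma remainingS tot cap sg k x : 0 <= cap ->
  0 <= remaining tot cap sg k.+1 x <= remaining tot cap sg k x /\
  remaining tot cap sg k x - remaining tot cap sg k.+1 x <= cap.
Proof.
move=> u0; rewrite /remaining big_nat_recr//=.
have /andP[c0 c1] := clip_itv (sg k.+1 x) u0.
set s := \sum_(1 <= i < k.+1) _; set c := clip _ _ in c0 c1 *.
have [|] := leP 0 (tot - s) => ?; have [|] := leP 0 (tot - (s + c)) => ?.
- by split; [apply/andP; split|]; lra.
- by split; [apply/andP; split|]; lra.
- by split; [apply/andP; split|]; lra.
- by split; [apply/andP; split|]; lra.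
Qed.

(** At points where the conditional variances obey their bounds and add up to [tot], neither
    truncation is active. *)
Lemma remainingE tot cap sg n k x : (k <= n)%N ->
  (forall i, (1 <= i <= n)%N -> 0 <= sg i x <= cap) ->
  \sum_(1 <= i < n.+1) sg i x = tot ->
  remaining tot cap sg k x = tot - \sum_(1 <= i < k.+1) sg i x.
Proof.
move=> kn si <-; rewrite /remaining.
have -> : \sum_(1 <= i < k.+1) clip cap (sg i x) = \sum_(1 <= i < k.+1) sg i x.
  apply: eq_big_nat => i /andP[i1 ik]; rewrite clip_id// si// i1/=.
  by rewrite -ltnS (leq_trans ik).
rewrite max_r// (@big_cat_nat _ _ _ k.+1)//= addrAC subrr add0r.
rewrite big_nat_cond; apply: sumr_ge0 => i; rewrite andbT => /andP[ki iN].
by have /andP[] := si i (introT andP (conj (leq_trans (ltn0Sn k) ki) iN)).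
Qed.

End remaining_variance.

Lemma subfun_remaining d (T : measurableType d) {R : realType} n
    (F : nat -> set (set T)) (tot cap : R) (sg : nat -> T -> R) k :
  filtration n F ->
  (forall i, (1 <= i <= n)%N -> measurable_wrt (F i.-1) (sg i)) ->
  (k < n)%N -> subfun (F k) (remaining tot cap sg k.+1).
Proof.
move=> [_ sF FS] Fs kn; have [sFk _] := sF k (ltnW kn).
apply: measurable_maxr; first exact: measurable_cst.
apply: measurable_funB; first exact: measurable_cst.
rewrite (_ : (fun x => _) = (fun x => \sum_(i < k.+1) clip cap (sg i.+1 x))); last first.
  by apply/funext => x; rewrite big_add1 big_mkord.
apply: measurable_sum => i; apply: measurable_minr; last exact: measurable_cst.
apply: measurable_maxr; last exact: measurable_cst.
have ik : (i <= k)%N by rewrite -ltnS.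
apply: (@subfunS _ _ _ (F i)) => //.
- by have [] := sF i (leq_trans ik (ltnW kn)).
- by apply: FS; rewrite ik ltnW.
- apply/measurable_wrtP; first by have [] := sF i (leq_trans ik (ltnW kn)).
  by apply: (Fs i.+1); rewrite /= (leq_ltn_trans ik kn).
Qed.

(** With p one more than the binary integer logarithm, n + 1 <= 2^p < 4^p; the square arises because
    p counts scales of standard deviations. *)
Lemma log_scale (R : realType) n : (2 <= n)%N ->
  exists p : nat, (n%:R + 1 < (2 ^+ p) ^+ 2 :> R) /\ 1 + p%:R <= 3 * (ln n%:R / ln 2) :> R.
Proof.
move=> n2; have n0 : (0 < n)%N by exact: ltnW.
exists (trunc_log 2 n).+1; split.
  have h : (n.+1 <= 2 ^ (trunc_log 2 n).+1)%N by exact: trunc_log_ltn.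
  rewrite natr1 -!natrX ltr_nat; apply: (leq_ltn_trans h).
  by rewrite -expnM ltn_exp2l// muln2 -addnn -{1}(addn0 (trunc_log 2 n).+1) ltn_add2l.
have l2 : 0 < ln 2 :> R by rewrite ln_gt0// ltr1n.
have h : (2 ^ trunc_log 2 n <= n)%N by exact: trunc_logP.
have h1 : (trunc_log 2 n)%:R <= ln n%:R / ln 2 :> R.
  rewrite ler_pdivlMr// mulr_natl -lnXn//.
  by rewrite ler_ln ?posrE ?exprn_gt0 ?ltr0n// -natrX ler_nat.
(* For n >= 2 the additive 2 in 1 + p is absorbed into twice the binary logarithm, whence the factor
   3. *)
have h2 : 1 <= ln n%:R / ln 2 :> R.
  by rewrite ler_pdivlMr// mul1r ler_ln ?posrE ?ltr0n// ler_nat.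
by rewrite -natr1; lra.
Qed.

(** * Integrability and moment bounds for members of the class *)

Section class_M_facts.
Context d (T : measurableType d) {R : realType} (P : probability T R).
Variables (n : nat) (gamma : nat -> R) (F : nat -> set (set T)) (X : nat -> T -> R).
Hypothesis MX : class_M P n gamma F X.

Local Notation "'Ex' f" := (\int[P]_x f x) (at level 10, f at level 9).
Local Notation intg f := (P.-integrable setT (EFin \o f)).
(** The third-moment bound is stated with the nonnegative part of [un], because the positivity of
    [un] is itself derived from that bound in [class_M_un_gt0]. *)
Local Notation w := (Num.max (un n gamma) 0).

Lemma class_M_sigma k : (k <= n)%N -> sigma_algebra setT (F k).
Proof. by case: MX => -[[_ + _] _] _ _ kn => /(_ k kn)[]. Qed.

Lemma class_M_sub k : (k <= n)%N -> F k `<=` measurable.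
Proof. by case: MX => -[[_ + _] _] _ _ kn => /(_ k kn)[]. Qed.

Lemma class_M_le j k : (j <= k <= n)%N -> F j `<=` F k.
Proof. by case: MX => -[[_ _ +] _] _ _; exact. Qed.

Lemma class_M_integrable k : (k < n)%N -> intg (X k.+1).
Proof. by case: MX => -[_ +] _ _ kn => /(_ k.+1 kn)[]. Qed.

Lemma class_M_subfun k : (k < n)%N -> subfun (F k.+1) (X k.+1).
Proof.
case: MX => -[_ +] _ _ kn => /(_ k.+1 kn)[mX _ _].
by apply/measurable_wrtP => //; exact: class_M_sigma.
Qed.

Lemma class_M_mean0 k A : (k < n)%N -> F k A -> \int[P]_(x in A) X k.+1 x = 0.
Proof.
case: MX => -[_ +] _ _ kn => /(_ k.+1 kn)[_ _ [_ cX]] FA.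
by rewrite /Rintegral -(cX A FA) integral0.
Qed.

Lemma class_M_integrable2 k : (k < n)%N -> intg (fun x => X k.+1 x ^+ 2).
Proof.
move=> kn; have mX := intg_measurable (class_M_integrable kn).
case: MX => _ /(_ k.+1 kn) + _; rewrite unlock => h.
apply/integrableP; split; first by apply/measurable_EFinP; exact: measurable_funX.
by under eq_integral do rewrite /= ger0_norm ?sqr_ge0//.
Qed.

Lemma gamma_le_un k : (1 <= k <= n)%N -> gamma k <= un n gamma.
Proof.
move=> /andP[k1 kn]; apply: (@le_bigmax_seq _ _ _ _ _ k xpredT gamma) => //.
by rewrite mem_index_iota k1 ltnS.
Qed.

Let third k A : (k < n)%N -> F k A ->
  (\int[P]_(x in A) (`|X k.+1 x| ^+ 3)%:E <=
   w%:E * \int[P]_(x in A) (X k.+1 x ^+ 2)%:E)%E.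
Proof.
move=> kn FA; case: MX => _ _ /(_ k.+1 kn)[m3 [m2 [c3 c2 m32]]].
have mX := intg_measurable (class_M_integrable kn).
apply: (condexp_le (class_M_sub (ltnW kn)) _ _ _ _ c3 c2 m32) => //.
- by apply: measurable_funX; exact: measurableT_comp.
- exact: measurable_funX.
- by move=> x; rewrite sqr_ge0.
- by rewrite le_max gamma_le_un.
- by rewrite le_max lexx orbT.
Qed.

Lemma class_M_integrable3 k : (k < n)%N -> intg (fun x => `|X k.+1 x| ^+ 3).
Proof.
move=> kn; have mX := intg_measurable (class_M_integrable kn).
apply/integrableP; split.
  by apply/measurable_EFinP; apply: measurable_funX; exact: measurableT_comp.
under eq_integral do rewrite /= ger0_norm ?exprn_ge0//.
have FT : F k setT.
  by case: (class_M_sigma (ltnW kn)) => G0 GD _; rewrite -(setD0 setT); exact: GD.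
apply: (le_lt_trans (third kn FT)).
have /integrableP[_] := class_M_integrable2 kn.
under eq_integral do rewrite /= ger0_norm ?sqr_ge0//.
by move=> h; apply: lte_mul_pinfty; rewrite ?lee_fin ?le_max ?lexx ?orbT.
Qed.

Lemma class_M_third k A : (k < n)%N -> F k A ->
  \int[P]_(x in A) (`|X k.+1 x| ^+ 3 - w * X k.+1 x ^+ 2) <= 0.
Proof.
move=> kn FA; have mA : measurable A by exact: (class_M_sub (ltnW kn)).
have i2 : P.-integrable A (EFin \o (fun x => X k.+1 x ^+ 2)).
  by apply: integrableS (class_M_integrable2 kn).
have i3 : P.-integrable A (EFin \o (fun x => `|X k.+1 x| ^+ 3)).
  by apply: integrableS (class_M_integrable3 kn).
rewrite RintegralB//; last exact: integrableZl i2.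
rewrite RintegralZl// subr_le0 -lee_fin EFinM !fineK//.
- exact: third.
- exact: (integrable_fin_num mA i2).
- exact: (integrable_fin_num mA i3).
Qed.

Lemma tau2E k : tau2 P X k = \int[P]_x (X k x ^+ 2).
Proof. by rewrite /tau2 unlock. Qed.

(** If [un] were nonpositive, the third moments would vanish. A positive second moment e = s^2 would
    then give 3 s^3 <= s^3, from the cubic inequality (y - s)^2 (2 y + s) >= 0; so all second
    moments, and with them v, would be zero. *)
Lemma class_M_un_gt0 : 0 < vn P n X -> 0 < un n gamma.
Proof.
move=> v0; rewrite ltNge; apply/negP => u0; move: v0.
rewrite /vn sqrtr_gt0 /vn2 big_add1 /= big_mkord ltNge => /negP; apply.
apply: sumr_le0 => k _; have kn := ltn_ord k; rewrite tau2E.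
have i2 := class_M_integrable2 kn; have i3 := class_M_integrable3 kn.
have FT : F k setT.
  by case: (class_M_sigma (ltnW kn)) => G0 GD _; rewrite -(setD0 setT); exact: GD.
have h3 : \int[P]_x (`|X k.+1 x| ^+ 3) <= 0.
  have := class_M_third kn FT; rewrite (max_r u0) => h; apply: le_trans h.
  by rewrite le_eqVlt; apply/orP; left; apply/eqP/eq_Rintegral => x _; rewrite mul0r subr0.
rewrite leNgt; apply/negP; set e := Rintegral _ _ _ => e0.
pose s := Num.sqrt e; have s0 : 0 < s by rewrite sqrtr_gt0.
have ee : e = s ^+ 2 by rewrite sqr_sqrtr// ltW.
have : 3 * s * e <= 2 * \int[P]_x (`|X k.+1 x| ^+ 3) + s ^+ 3.
  rewrite -[X in _ + X](Ex_cst P) -ExZ// -ExZ// -ExD; [|exact: intgZ|exact: intg_cst].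
  apply: Ex_le; [exact: intgZ|by apply: intgD; [exact: intgZ|exact: intg_cst]|].
  move=> x; rewrite -(real_normK (num_real (X k.+1 x))).
  have y0 := normr_ge0 (X k.+1 x); set y := `|X k.+1 x| in y0 *.
  have : 0 <= (y - s) ^+ 2 * (2 * y + s) by rewrite mulr_ge0 ?sqr_ge0//; lra.
  rewrite (_ : (y - s) ^+ 2 * _ = 2 * y ^+ 3 - 3 * s * y ^+ 2 + s ^+ 3); last by ring.
  by lra.
rewrite ee (_ : 3 * s * s ^+ 2 = 3 * s ^+ 3); last by ring.
have : 0 < s ^+ 3 by rewrite exprn_gt0.
by lra.
Qed.

End class_M_facts.

(** Almost surely each sigma_i^2 lies in [0, u^2] by [cond_variance_le], and V_n^2 = 1 makes them
    add up to v^2. Hence r_k is v^2 minus the first k of them, and r_k - r_(k+1) is a version of the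
    conditional variance of X_(k+1). *)
Lemma remaining_class_M d (T : measurableType d) {R : realType}
    (P : probability T R) n (gamma : nat -> R) (F : nat -> set (set T))
    (X sg : nat -> T -> R) (r := remaining (vn2 P n X) (un n gamma ^+ 2) sg) :
  class_M P n gamma F X -> is_sigma2 P n F X sg -> 0 < vn P n X ->
  {ae P, forall x, Vn2 P n X sg x = 1} ->
  {ae P, forall x, r n x = 0} /\
  forall k A, (k < n)%N -> F k A ->
    \int[P]_(x in A) (X k.+1 x ^+ 2 - (r k x - r k.+1 x)) = 0.
Proof.
move=> MX hs v0 hV; have u0 := class_M_un_gt0 MX v0.
have cap0 : 0 <= un n gamma ^+ 2 by exact: sqr_ge0.
have vv0 : vn2 P n X != 0 by move: v0; rewrite /vn sqrtr_gt0 => /gt_eqF ->.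
have sg_itv : {ae P, forall x, forall i, (1 <= i <= n)%N -> 0 <= sg i x <= un n gamma ^+ 2}.
  apply: ae_foralln => -[|i]; first by apply: aeW => x; rewrite ltnn.
  have [iN|] := ltnP i n; last first.
    by move=> ni; apply: aeW => x; rewrite andbF.
  have kn := ltnW iN.
  have i2 := class_M_integrable2 MX iN; have i3 := class_M_integrable3 MX iN.
  have c2 : condexp_version P (F i) (fun x => X i.+1 x ^+ 2) (sg i.+1) by exact: (hs i.+1).
  have ge0 := condexp_ge0 (class_M_sub MX kn) (intg_measurable i2) (fun=> sqr_ge0 _) c2.
  have leu : {ae P, forall x, sg i.+1 x <= un n gamma ^+ 2}.
    apply: (cond_variance_le (class_M_sigma MX kn) (class_M_sub MX kn) u0 i2 i3 _ c2).
    by move=> A FA; have := class_M_third MX iN FA; rewrite (max_l (ltW u0)).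
  by apply: filterS2 ge0 leu => x -> ->.
have rE : {ae P, forall x, forall k, (k <= n)%N ->
    r k x = vn2 P n X - \sum_(1 <= i < k.+1) sg i x}.
  apply: filterS2 sg_itv hV => x h1 h2 k kn; apply: remainingE kn h1 _.
  by move: h2; rewrite /Vn2 => /(congr1 ( *%R (vn2 P n X))); rewrite mulVKf// mulr1.
split.
  apply: filterS2 rE hV => x /(_ n (leqnn n)) -> h2; apply/eqP; rewrite subr_eq0; apply/eqP.
  by move: h2; rewrite /Vn2 => /(congr1 ( *%R (vn2 P n X))); rewrite mulVKf// mulr1.
move=> k A kn FA; have mA : measurable A by exact: (class_M_sub MX (ltnW kn)).
have sF : filtration n F by case: MX => -[].
have mr j : (j <= n)%N -> measurable_fun setT (r j).
  case: j => [_|j jn].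
    rewrite (_ : r 0%N = cst (Num.max 0 (vn2 P n X))) //.
    by apply/funext => x; rewrite /r /remaining big_geq// subr0.
  apply: (subfun_measurable (class_M_sigma MX (ltnW jn)) (class_M_sub MX (ltnW jn))).
  by apply: (subfun_remaining _ _ sF) => // i iN; have [] := hs i iN.
have c2 : condexp_version P (F k) (fun x => X k.+1 x ^+ 2) (sg k.+1) by exact: (hs k.+1).
have i2 := class_M_integrable2 MX kn.
have isg := condexp_integrable (class_M_sigma MX (ltnW kn)) (class_M_sub MX (ltnW kn))
  i2 (fun=> sqr_ge0 _) c2.
have mrr : measurable_fun setT (fun x => r k x - r k.+1 x).
  by apply: measurable_funB; apply: mr => //; exact: ltnW.
have irr : P.-integrable setT (EFin \o (fun x => r k x - r k.+1 x)).
  apply: (@intg_bounded _ _ _ P _ (un n gamma ^+ 2) mrr) => x.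
  have [/andP[_ h1] h2] := remainingS (vn2 P n X) sg k x cap0.
  by rewrite ger0_norm// subr_ge0.
have iA f : P.-integrable setT (EFin \o f) -> P.-integrable A (EFin \o f).
  by exact: integrableS.
rewrite RintegralB//; [|exact: iA|exact: iA].
apply/eqP; rewrite subr_eq0; apply/eqP; congr fine.
rewrite -(c2.2 A FA); apply: ae_eq_integral => //.
- by apply: measurable_funTS; exact: measurable_int isg.
- by apply: measurable_funTS; exact/measurable_EFinP.
- apply: filterS rE => x h _.
  have -> // : r k x - r k.+1 x = sg k.+1 x.
  by rewrite (h k (ltnW kn)) (h k.+1 kn) [in X in _ - (_ - X)]big_nat_recr//=; ring.
Qed.

Lemma Delta_le1 d (T : measurableType d) {R : realType} (P : probability T R) n
    (X : nat -> T -> R) : measurable_fun setT (Sn n X) ->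
  ubound [set `|fine (P [set x | Sn n X x / vn P n X <= t]) - Phi t| | t in [set: R]] 1.
Proof.
move=> mS _ [s _ <-].
have mA : measurable [set x | Sn n X x / vn P n X <= s].
  have mSv : measurable_fun setT (fun x => Sn n X x / vn P n X) by exact: measurable_funM.
  have := mSv measurableT _ (measurable_itv `]-oo, s]).
  by rewrite setTI; congr measurable; apply/seteqP; split => x /=; rewrite in_itv.
have p0 : 0 <= fine (P [set x | Sn n X x / vn P n X <= s]) by exact: fine_ge0.
have p1 : fine (P [set x | Sn n X x / vn P n X <= s]) <= 1.
  by rewrite -lee_fin fineK ?fin_num_measure// probability_le1.
have := Phi_ge0 s; have := Phi_le1 s.
by rewrite ler_norml => *; apply/andP; split; lra.
Qed.

Lemma DeltaP d (T : measurableType d) {R : realType} (P : probability T R) n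
    (X : nat -> T -> R) t : measurable_fun setT (Sn n X) -> 0 < vn P n X ->
  `|fine (P [set x | Sn n X x <= t]) - Phi (t / vn P n X)| <= Delta P n X.
Proof.
move=> mS v0; apply: ub_le_sup; first by exists 1; exact: Delta_le1.
exists (t / vn P n X) => //; congr (`|fine (P _) - _|).
by apply/seteqP; split => x /=; rewrite ler_pM2r ?invr_gt0.
Qed.

(* For n = 1 the right-hand side is 0 because log 1 = 0, and the bound fails:
   take gamma_k = 1 and X_1 = +-1 with probability 1/2 each. Hence 2 <= n. *)
Theorem theorem1 (R : realType) (gamma : nat -> R) :
  exists L : R, 0 < L /\
    forall (d : measure_display) (T : measurableType d) (P : probability T R)
      (n : nat) (F : nat -> set (set T)) (X sigma2 : nat -> T -> R),
      (2 <= n)%N ->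
      class_M P n gamma F X ->
      is_sigma2 P n F X sigma2 ->
      0 < vn P n X ->
      {ae P, forall x, Vn2 P n X sigma2 x = 1} ->
      Delta P n X <= L * (un n gamma * ln n%:R / vn P n X).
Proof.
have [K K0 expansion] := @Phi_step_expansion R.
(* [c] and [M] make the two coefficients of D in [self_improvement] at most 1/4; the summand 1 in
   [M] also ensures u <= M u. *)
pose c : R := 4 * (72 * 16).
pose M : R := 1 + 4 * (6 * 256 * K).
pose C : R := 6 * 400 * K + M * (54 + c + 72 * 25).
have c1 : 1 <= c by rewrite /c; lra.
have M1 : 1 <= M by rewrite /M; lra.
have CM : M <= C.
  have : M * 1 <= M * (54 + c + 72 * 25) by rewrite ler_wpM2l//; lra.
  by rewrite /C; lra.
have C0 : 0 < C by lra.
have l2 : 0 < ln 2 :> R by rewrite ln_gt0// ltr1n.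
(* The 2 comes from solving D <= D / 2 + ..., and 3 / ln 2 from [log_scale]. *)
exists (2 * C * (3 / ln 2)); split; first by rewrite !mulr_gt0 ?invr_gt0.
move=> d T P n F X sg n2 MX hs v0 hV.
have u0 := class_M_un_gt0 MX v0; set u := un n gamma in u0 *; set v := vn P n X in v0 *.
have [rn X2] := remaining_class_M MX hs v0 hV.
set r := remaining _ _ _ in rn X2.
have v2 : vn2 P n X = v ^+ 2.
  by rewrite /v /vn sqr_sqrtr// ltW//; move: v0; rewrite /v /vn sqrtr_gt0.
have cap0 : 0 <= u ^+ 2 by exact: sqr_ge0.
have sF := @class_M_sigma _ _ _ _ _ _ _ _ MX.
have FT := @class_M_sub _ _ _ _ _ _ _ _ MX.
have FS := @class_M_le _ _ _ _ _ _ _ _ MX.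
have FX := @class_M_subfun _ _ _ _ _ _ _ _ MX.
have Fr k : (k < n)%N -> subfun (F k) (r k.+1).
  have fF : filtration n F by case: MX => -[].
  by move=> kn; apply: (subfun_remaining _ _ fF) => // i iN; have [] := hs i iN.
have r0 x : r 0%N x = v ^+ 2 by rewrite -v2 /r remaining0// v2 sqr_ge0.
have r_decr k x : (k < n)%N -> 0 <= r k.+1 x <= r k x.
  by have [] := remainingS (vn2 P n X) sg k x cap0.
have r_step k x : (k < n)%N -> r k x - r k.+1 x <= u ^+ 2.
  by have [] := remainingS (vn2 P n X) sg k x cap0.
have X3 k A : (k < n)%N -> F k A ->
    \int[P]_(x in A) (`|X k.+1 x| ^+ 3 - u * X k.+1 x ^+ 2) <= 0.
  by move=> kn FA; have := class_M_third MX kn FA; rewrite (max_l (ltW u0)).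
have mS : measurable_fun setT (Sn n X).
  apply: (subfun_measurable (sF n (leqnn n)) (FT n (leqnn n))).
  exact: (subfun_Sn sF FS FX (leqnn n)).
have vu := v_le_u sF FT FS Fr r0 r_decr r_step rn.
have [p [np pl]] := log_scale R n2.
have uv0 : 0 < u / v by exact: divr_gt0.
set D := Delta P n X.
have Dne : [set `|fine (P [set x | Sn n X x / vn P n X <= t]) - Phi t| | t in [set: R]]
    !=set0 by apply/image_nonempty; exists 0.
suff DC : D <= 2 * C * (1 + p%:R) * (u / v).
  apply: (le_trans DC); rewrite -/u -/v -!mulrA ler_pM2l// ler_pM2l//.
  rewrite (_ : 3 * _ = 3 * (ln n%:R / ln 2) * (u / v)); last by ring.
  by rewrite ler_pM2r.
have p0 := mulr_ge0 (mulr_ge0 (ler0n R p) (ltW uv0)) (ltW C0).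
(* If the smoothing scale M u exceeds v, the bound is trivial: D <= 1 <= C u / v. *)
have [av|va] := leP (M * u) v; last first.
  have D1 : D <= 1 by apply: ge_sup => //; exact: Delta_le1.
  have : 1 <= M * (u / v) by rewrite mulrA ler_pdivlMr// mul1r ltW.
  have : M * (u / v) <= C * (u / v) by rewrite ler_pM2r.
  have -> : 2 * C * (1 + p%:R) * (u / v) = 2 * (C * (u / v)) + 2 * (p%:R * (u / v) * C).
    by ring.
  lra.
have ua : u <= M * u by rewrite ler_peMl// ltW.
(* Since v^2 <= n u^2, the left-hand side is at most (n + 1) (M u)^2, and n + 1 < 4^p. *)
have hp : (M * u) ^+ 2 + v ^+ 2 < (2 ^+ p * (M * u)) ^+ 2.
  have a2 : u ^+ 2 <= (M * u) ^+ 2 by rewrite lerXn2r ?nnegrE ?(ltW u0) ?(le_trans (ltW u0) ua).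
  have a0 : 0 < (M * u) ^+ 2 by rewrite exprn_gt0// (lt_le_trans u0).
  rewrite (exprMn _ (2 ^+ p)); apply: (@le_lt_trans _ _ ((n%:R + 1) * (M * u) ^+ 2)).
    have : n%:R * u ^+ 2 <= n%:R * (M * u) ^+ 2 by rewrite ler_wpM2l.
    by rewrite mulrDl mul1r; lra.
  by rewrite ltr_pM2r.
have DP t : `|fine (P [set x | Sn n X x <= t]) - Phi (t / v)| <= D by exact: DeltaP.
(* [self_improvement] holds for every t with D = Delta as its own a priori bound, so the supremum
   may be taken; D is a real number, hence D / 2 can be subtracted. *)
have half : D <= D / 2 + C * (1 + p%:R) * (u / v).
  apply: ge_sup => // _ [t _ <-].
  have -> : [set x | Sn n X x / vn P n X <= t] = [set x | Sn n X x <= t * v].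
    by apply/seteqP; split => x /=; rewrite ler_pdivrMr.
  have -> : Phi t = Phi (t * v / v) by rewrite mulfK// gt_eqF.
  apply: (@self_improvement _ _ _ P n F X r u v (M * u)) => //.
  - exact: class_M_integrable MX.
  - exact: class_M_integrable2 MX.
  - exact: class_M_integrable3 MX.
  - by move=> k A; exact: (class_M_mean0 MX).
  - by rewrite /c; lra.
  - by rewrite /M; lra.
by lra.
Qed.
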